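(* Let $n\ge1$. Given an integer $m\ge0$, let the non-negative integer array $\mathbf r=(r_0,r_1,\dots,r_n)$ satisfy $r_n=0$, $r_{n-1}=m$, and $r_\ell\ge2r_{\ell+1}$ for $\ell=n-2,\dots,0$. Let $k\ge2r_0+1\ge2^nm+1$. Let $\mathcal T_h$ be a conforming simplicial mesh of a domain $\Omega\subset\mathbb R^n$. The degrees of freedom (F0) $D^\alpha u(\mathtt v)$, $\alpha\in\mathbb N^{1:n}$, $|\alpha|\le r_0$, $\mathtt v\in\Delta_0(\mathcal T_h)$; (F1) $\int_f\frac{\partial^\beta u}{\partial n_f^\beta}\,\lambda_f^{\alpha_f}\,ds$, $\alpha\in S_\ell(f)$, $|\alpha_f|=k-s$, $\beta\in\mathbb N^{1:n-\ell}$, $|\beta|=s$, $s=0,\dots,r_\ell$, $f\in\Delta_\ell(\mathcal T_h)$, $\ell=1,\dots,n-1$; (F2) $\int_Tu\,\lambda^\alpha\,dx$, $\alpha\in S_n(T)$, $T\in\mathcal T_h$, define a finite element space $$V_h=\{u\in C^m(\Omega):\ \text{DoFs (F0)–(F1) are single valued},\ u|_T\in\mathbb P_k(T)\ \forall T\in\mathcal T_h\}.$$ That is: for every assignment of values to the DoFs (F0)–(F2) there is a unique piecewise polynomial $u$ with $u|_T\in\mathbb P_k(T)$ for all $T\in\mathcal T_h$ whose DoFs (computed from every simplex containing the given subsimplex) take these values, and this $u$ belongs to $C^m(\Omega)$.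
   Context: $\mathbb N^{a:b}$ denotes multi-indices $(\alpha_a,\dots,\alpha_b)$ of nonnegative integers, $|\alpha|$ the sum of the entries. For an $n$-simplex $T$ with vertices indexed $0,\dots,n$ and barycentric coordinates $\lambda_0,\dots,\lambda_n$, $\Delta_\ell(T)$ is the set of $\ell$-dimensional subsimplices (with $\Delta_\ell(\mathcal T_h)$ those of the mesh), a subsimplex $f$ is identified with its set of vertex indices, and $f^*$ is the complementary index set. $\mathbb T_k^n(T)=\{\alpha\in\mathbb N^{0:n}:|\alpha|=k\}$, $\lambda^\alpha=\prod\lambda_i^{\alpha_i}$. For $\alpha\in\mathbb T_k^n$, $\alpha_f$ and $\alpha_{f^*}$ are the restrictions of $\alpha$ to the indices in $f$ and $f^*$, so $|\alpha|=|\alpha_f|+|\alpha_{f^*}|$, and $\lambda_f^{\alpha_f}=\prod_{i\in f}\lambda_i^{\alpha_i}$. $\operatorname{dist}(\alpha,f)=|\alpha_{f^*}|$ and $D(f,r)=\{\alpha\in\mathbb T_k^n(T):\operatorname{dist}(\alpha,f)\le r\}$. The sets $S_0(\mathtt v)=D(\mathtt v,r_0)$, $S_\ell(f)=D(f,r_\ell)\setminus\bigcup_{i=0}^{\ell-1}\bigcup_{e\in\Delta_i(f)}D(e,r_i)$ for $\ell=1,\dots,n-1$, $S_n(T)=\mathbb T_k^n(T)\setminus\bigcup_{i=0}^{n-1}\bigcup_{f\in\Delta_i(T)}D(f,r_i)$. For $f$ of dimension $\ell$, $n_f=\{n_f^1,\dots,n_f^{n-\ell}\}$ are $n-\ell$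 fixed vectors (depending only on $f$) spanning the normal plane of $f$, and $\frac{\partial^\beta}{\partial n_f^\beta}=\prod_i\partial_{n_f^i}^{\beta_i}$. In (F1) the DoFs are indexed by the distinct pairs $(\alpha_f,\beta)$, where $\alpha_f$ runs over the $f$-components of those $\alpha\in S_\ell(f)$ with $|\alpha_f|=k-s$ (this set depends only on $f$, not on the $T$ containing it). $\mathbb P_k(T)$ is the space of polynomials of degree $\le k$. *)

(* Defs.v *)
From HB Require Import structures.
From mathcomp Require Import all_boot all_order all_algebra.
From mathcomp Require Import all_classical all_reals all_analysis.
(* The notations of mpoly are incompatible with those of mathcomp-analysis. *)
From mathcomp Require Export -(notations) mpoly.

Set Implicit Arguments.
Unset Strict Implicit.
Unset Printing Implicit Defensive.

Import Order.TTheory GRing.Theory Num.Theory.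
Import numFieldNormedType.Exports.

Local Open Scope classical_set_scope.
Local Open Scope ring_scope.

(* Mesh vertices are indexed by a finite type V, with coordinates
   X : V -> 'rV[R]_n; a simplex is the set of the indices of its vertices. *)

Definition bary_coords (R : realType) (n : nat) (V : finType)
    (X : V -> 'rV[R]_n) (T : {set V}) (x : 'rV[R]_n) (w : V -> R) : Prop :=
  [/\ forall i, i \notin T -> w i = 0,
      \sum_(i in T) w i = 1 &
      \sum_(i in T) w i *: X i = x].

(* Only meaningful when T is affinely independent and x is in its affine hull:
   the coordinates then exist and are unique. *)
Definition bary (R : realType) (n : nat) (V : finType)
    (X : V -> 'rV[R]_n) (T : {set V}) (x : 'rV[R]_n) : V -> R :=
  xget (fun=> 0) [set w | bary_coords X T x w].

Definition simplex_hull (R : realType) (n : nat) (V : finType)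
    (X : V -> 'rV[R]_n) (T : {set V}) : set 'rV[R]_n :=
  [set x | exists2 w : V -> R,
     bary_coords X T x w & forall i, 0 <= w i].

Definition affinely_independent (R : realType) (n : nat) (V : finType)
    (X : V -> 'rV[R]_n) (T : {set V}) : Prop :=
  forall w : V -> R,
    \sum_(i in T) w i = 0 -> \sum_(i in T) w i *: X i = 0 ->
    forall i, i \in T -> w i = 0.

Definition is_domain (R : realType) (n : nat) (Omega : set 'rV[R]_n) : Prop :=
  [/\ open Omega, connected Omega & Omega !=set0].

(* As the hull of the empty set is empty, mesh_conform says that two simplices
   are disjoint or meet along the common subsimplex spanned by their common
   vertices. *)
Record conforming_mesh (R : realType) (n : nat) (V : finType)
    (X : V -> 'rV[R]_n) (Omega : set 'rV[R]_n) (Th : {set {set V}}) : Prop := {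
  mesh_dim : forall T, T \in Th -> #|T| = n.+1;
  mesh_nondegenerate : forall T, T \in Th -> affinely_independent X T;
  mesh_conform : forall T T', T \in Th -> T' \in Th ->
    simplex_hull X T `&` simplex_hull X T' = simplex_hull X (T :&: T');
  mesh_cover :
    \bigcup_(T in [set` Th]) simplex_hull X T = closure Omega
}.

Definition Delta (V : finType) (l : nat) (T : {set V}) : {set {set V}} :=
  [set f : {set V} | (f \subset T) && (#|f| == l.+1)].

(* Multi-indices on the vertices of T are functions on all of V vanishing
   outside T. A restriction alpha_f is likewise extended by zero, so that it
   does not depend on the simplex containing f. *)

Definition mlattice (V : finType) (k : nat) (T : {set V})
    (alpha : {ffun V -> nat}) : bool :=
  [forall i, (i \notin T) ==> (alpha i == 0%N)]
  && (\sum_(i in T) alpha i == k)%N.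

Definition mrestr (V : finType) (f : {set V}) (alpha : {ffun V -> nat}) :
    {ffun V -> nat} :=
  [ffun i => if i \in f then alpha i else 0%N].

Definition mdeg_on (V : finType) (f : {set V}) (alpha : {ffun V -> nat}) :
    nat :=
  (\sum_(i in f) alpha i)%N.

Definition mdist (V : finType) (T f : {set V}) (alpha : {ffun V -> nat}) :
    nat :=
  mdeg_on (T :\: f) alpha.

Definition mball (V : finType) (k : nat) (T f : {set V}) (rho : nat)
    (alpha : {ffun V -> nat}) : bool :=
  mlattice k T alpha && (mdist T f alpha <= rho)%N.

Definition mball_lower (V : finType) (k : nat) (r : nat -> nat) (T : {set V})
    (l : nat) (f : {set V}) (alpha : {ffun V -> nat}) : bool :=
  [exists i : 'I_l, [exists e in Delta i f, mball k T e (r i) alpha]].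

Definition Sface (V : finType) (k : nat) (r : nat -> nat) (T : {set V})
    (l : nat) (f : {set V}) (alpha : {ffun V -> nat}) : bool :=
  mball k T f (r l) alpha && ~~ mball_lower k r T l f alpha.

Definition Scell (V : finType) (k : nat) (r : nat -> nat) (n : nat)
    (T : {set V}) (alpha : {ffun V -> nat}) : bool :=
  mlattice k T alpha && ~~ mball_lower k r T n T alpha.

(* The lambda_i, also those with i \in f, are the coordinates relative to the
   whole cell T; on f they agree with those of f. *)
Definition bary_monomial (R : realType) (n : nat) (V : finType)
    (X : V -> 'rV[R]_n) (T f : {set V}) (alpha : {ffun V -> nat})
    (x : 'rV[R]_n) : R :=
  \prod_(i in f) bary X T x i ^+ alpha i.

(* Integral over {t | t_j >= 0, \sum_j t_j <= c}, as an iterated integral. *)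
Fixpoint ref_simplex_int (R : realType) (l : nat) (c : R) :
    ('rV[R]_l -> R) -> R :=
  match l return ('rV[R]_l -> R) -> R with
  | 0%N => fun g => g 0
  | l'.+1 => fun g =>
      \int[lebesgue_measure]_(t in `[0, c])
        ref_simplex_int (c - t) (fun u : 'rV[R]_l' => g (row_mx t%:M u))
  end.

(* Surface integral over the simplex f, parametrized by the reference simplex
   through t |-> X v0 + t *m E where the rows of E are the edges at a vertex
   v0; the surface element is the square root of the Gram determinant. For a
   cell of full dimension this is the volume element |det E|. *)
Definition simplex_int (R : realType) (n : nat) (V : finType)
    (X : V -> 'rV[R]_n) (f : {set V}) (g : 'rV[R]_n -> R) : R :=
  if enum f is v0 :: s then
    let E : 'M[R]_(size s, n) :=
      \matrix_(j < size s) (X (nth v0 s j) - X v0) in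
    Num.sqrt (\det (E *m E^T)) *
    ref_simplex_int 1 (fun t : 'rV[R]_(size s) => g (X v0 + t *m E))
  else 0.

Definition peval (R : realType) (n : nat) (p : mpoly n R) (x : 'rV[R]_n) : R :=
  meval (fun i => x 0 i) p.

Definition dirder (R : realType) (n : nat) (w : 'rV[R]_n) (p : mpoly n R) :
    mpoly n R :=
  \sum_(i < n) w 0 i *: mderiv i p.

(* The derivative of order beta along the rows of W. *)
Definition frame_der (R : realType) (n q : nat) (W : 'M[R]_(q, n))
    (beta : multinom q) (p : mpoly n R) : mpoly n R :=
  foldr (fun i : 'I_q => iter (beta i) (dirder (row i W))) p (enum 'I_q).

Definition normal_frame (R : realType) (n : nat) (V : finType)
    (X : V -> 'rV[R]_n) (f : {set V}) (q : nat) (W : 'M[R]_(q, n)) : Prop :=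
  forall w : 'rV[R]_n,
    (w <= W)%MS <->
    (forall i j, i \in f -> j \in f -> w *m (X i - X j)^T = 0).

Fixpoint classC (R : realType) (n m : nat) (Omega : set 'rV[R]_n)
    (u : 'rV[R]_n -> R^o) : Prop :=
  (forall x, Omega x -> {for x, continuous u}) /\
  match m with
  | 0%N => True
  | m'.+1 => forall i : 'I_n,
      (forall x, Omega x -> derivable u x (delta_mx 0 i)) /\
      classC m' Omega (fun x => 'D_(delta_mx 0 i) u x)
  end.

(* A piecewise polynomial is a family u of polynomials, of which only the
   members u T with T \in Th matter. *)

Definition piecewise_poly (R : realType) (n : nat) (V : finType) (k : nat)
    (Th : {set {set V}}) (u : {set V} -> mpoly n R) : Prop :=
  forall T, T \in Th -> (msize (u T) <= k.+1)%N.

Definition vertex_dofs (R : realType) (n : nat) (V : finType)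
    (X : V -> 'rV[R]_n) (r : nat -> nat) (Th : {set {set V}})
    (u : {set V} -> mpoly n R) (d : V -> multinom n -> R) : Prop :=
  forall T v, T \in Th -> v \in T ->
  forall alpha : multinom n, (mdeg alpha <= r 0%N)%N ->
    peval (mderivm alpha (u T)) (X v) = d v alpha.

(* The values d depend on alpha only through its restriction to f. *)
Definition face_dofs (R : realType) (n : nat) (V : finType)
    (X : V -> 'rV[R]_n) (k : nat) (r : nat -> nat) (Th : {set {set V}})
    (nf : forall l : nat, {set V} -> 'M[R]_(n - l, n))
    (u : {set V} -> mpoly n R)
    (d : forall l : nat, {set V} -> {ffun V -> nat} -> multinom (n - l) -> R) :
    Prop :=
  forall (T : {set V}) (l : nat) (f : {set V}),
    T \in Th -> (1 <= l <= n.-1)%N -> f \in Delta l T ->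
  forall (s : nat) (alpha : {ffun V -> nat}) (beta : multinom (n - l)),
    (s <= r l)%N -> Sface k r T l f alpha ->
    mdeg_on f alpha = (k - s)%N -> mdeg beta = s ->
    simplex_int X f (fun x => peval (frame_der (nf l f) beta (u T)) x *
                              bary_monomial X T f alpha x)
    = d l f (mrestr f alpha) beta.

Definition cell_dofs (R : realType) (n : nat) (V : finType)
    (X : V -> 'rV[R]_n) (k : nat) (r : nat -> nat) (Th : {set {set V}})
    (u : {set V} -> mpoly n R) (d : {set V} -> {ffun V -> nat} -> R) : Prop :=
  forall T, T \in Th -> forall alpha, Scell k r n T alpha ->
    simplex_int X T (fun x => peval (u T) x * bary_monomial X T T alpha x)
    = d T alpha.

(* Main.v *)
Require Import Defs.
From HB Require Import structures.
From mathcomp Require Import all_boot all_order all_algebra.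
From mathcomp Require Import all_classical all_reals all_analysis.
From mathcomp Require Import ring lra zify.

Set Implicit Arguments.
Unset Strict Implicit.
Unset Printing Implicit Defensive.

Import Order.TTheory GRing.Theory Num.Theory.
Import numFieldNormedType.Exports.

Local Open Scope classical_set_scope.
Local Open Scope ring_scope.

(** On a cell write u = sum_alpha c_alpha lambda^alpha with |alpha| = k. If c_alpha = 0
    whenever dist(alpha, f) < s, then for |beta| = s the derivative of u of order
    beta along a normal frame of f restricts on f to a combination of the
    lambda_f^{alpha_f} with dist(alpha, f) = s, and only those with alpha in S_l(f)
    survive once the coefficients attached to the subfaces of f vanish. Vanishing
    degrees of freedom say that this combination is L2-orthogonal on f to each of
    its own terms, so it is zero; since the gradients of the lambda_j with j off f
    are independent on the normal plane, c_alpha = 0 for dist(alpha, f) = s.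
    Induction on s and on the faces gives c_alpha = 0 on D(f, r_l). For f = T this is
    injectivity; every alpha lies in exactly one S_l(f), because r_i >= 2 r_j for
    i < j and k > 2 r_0, so the system is square and also solvable. For f the common
    face of two cells it says that the derivatives of order at most r_l, hence at
    most m, agree on f. *)

(** * Multivariate polynomials *)

(** Derivatives along a frame W at x are read off as coefficients of u(x + t W) in the variables t,
    which replaces Leibniz expansions: for x on f the factors lambda_j with j off f have no constant
    term in t, so at lowest order the factors on f enter only through their values at x. The order-s
    coefficients then assemble, for each interior point x of f, into one homogeneous polynomial in
    t. Since the gradients off f can be prescribed freely along the normal plane, its vanishing for
    all such x says that the part of the expansion at distance s vanishes at all points with
    positive coordinates, up to a scaling absorbed by homogeneity. The count of unknowns rests on a
    coincidence: f has as many normal directions as T has vertices off f, so a pair (alpha_f, beta)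
    is just alpha with its entries off f renamed. On a common face all partial derivatives agree,
    not only the normal ones: vanishing Bernstein coefficients near f control derivatives in every
    direction. *)

Local Notation mvar i := (mpolyX _ (mnm1 i)).
Local Notation msubst h := (comp_mpoly [tuple h i | i < _]).

Section MpolyAlgebra.
Variable R : comNzRingType.

(** Constants and variables generate the ring, so identities between ring morphisms or derivations
    need checking only there. *)
Lemma mpoly_ring_ind (n : nat) (P : mpoly n R -> Prop) :
  (forall c, P (mpolyC n c)) -> (forall i : 'I_n, P (mvar i)) ->
  (forall p q, P p -> P q -> P (p + q)) ->
  (forall p q, P p -> P q -> P (p * q)) ->
  forall p, P p.
Proof.
move=> PC PX PD PM p; rewrite [p]mpolyE.
apply: (big_ind P) => [|//|m _]; first by rewrite -mpolyC0.
rewrite -mul_mpolyC; apply: (PM); rewrite // mpolyXE_id.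
apply: (big_ind P) => [|//|i _]; first by rewrite -mpolyC1.
by elim: (m i) => [|e IH]; rewrite ?expr0 -?mpolyC1 // exprS; apply: PM.
Qed.

Lemma msubstX (n q : nat) (h : 'I_n -> mpoly q R) (i : 'I_n) :
  msubst h (mvar i) = h i.
Proof. by rewrite comp_mpolyXU -tnth_nth tnth_mktuple. Qed.

Lemma msubstE (n q : nat) (h : 'I_n -> mpoly q R) (p : mpoly n R) :
  msubst h p = \sum_(m <- msupp p) mcoeff m p *: \prod_(i < n) h i ^+ m i.
Proof.
rewrite comp_mpolyE; apply: eq_bigr => m _; congr (_ *: _).
by apply: eq_bigr => i _; rewrite tnth_mktuple.
Qed.

Lemma msubst_comp (n q l : nat) (h : 'I_n -> mpoly q R)
    (g : 'I_q -> mpoly l R) (p : mpoly n R) :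
  msubst g (msubst h p) = msubst (fun i => msubst g (h i)) p.
Proof.
elim/mpoly_ring_ind: p => [c|i|p1 p2 IH1 IH2|p1 p2 IH1 IH2].
- by rewrite !comp_mpolyC.
- by rewrite !msubstX.
- by rewrite !rmorphD /= IH1 IH2.
- by rewrite !rmorphM /= IH1 IH2.
Qed.

Lemma meval_msubst (n q : nat) (h : 'I_n -> mpoly q R) (v : 'I_q -> R)
    (p : mpoly n R) :
  meval v (msubst h p) = meval (fun i => meval v (h i)) p.
Proof.
by rewrite comp_mpoly_meval; apply: meval_eq => i; rewrite tnth_mktuple.
Qed.

(** Every monomial of [Q] already has degree s, so in degree at most s the cofactor [G] can only
    contribute its constant term. *)
Lemma mcoeffM_homog (n s : nat) (G Q : mpoly n R) (b : multinom n) :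
  Q \is ishomog1 s mdeg -> (mdeg b <= s)%N ->
  mcoeff b (G * Q) = mcoeff mnm0 G * mcoeff b Q.
Proof.
move=> Qh bs; rewrite -[in LHS](subrK (mpolyC n (mcoeff mnm0 G)) G) mulrDl.
rewrite mcoeffD mcoeffCM -[RHS]add0r; congr (_ + _).
rewrite mcoeffM big1 // => -[[k1 +] [k2 +]] /= => _ _ /eqP bE.
have [->|Qk] := eqVneq (mcoeff k2 Q) 0; first by rewrite mulr0.
have k2s : mdeg k2 = s by apply: (dhomogP _ _ _ Qh); rewrite mcoeff_msupp.
have : k1 == mnm0.
  by rewrite -mdeg_eq0; move: (congr1 mdeg bE) bs; rewrite mdegD k2s => ->; lia.
by move/eqP=> ->; rewrite mcoeffB mcoeffC eqxx mulr1 subrr mul0r.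
Qed.

Lemma homog_prod_exp (n N : nat) (P : pred 'I_N) (l : 'I_N -> mpoly n R)
    (m : 'I_N -> nat) :
  (forall i, l i \is ishomog1 1 mdeg) ->
  \prod_(i < N | P i) l i ^+ m i \is ishomog1 (\sum_(i < N | P i) m i)%N mdeg.
Proof.
move=> hl.
apply: (big_ind2 (fun (p : mpoly n R) d => p \is ishomog1 d mdeg)).
- exact: dhomog1.
- by move=> p1 d1 p2 d2; apply: dhomogM.
- by move=> i _; have := dhomogMn (m i) (hl i); rewrite mul1n.
Qed.

Lemma meval_homog (n s : nat) (Q : mpoly n R) (z : 'I_n -> R) (c : R) :
  Q \is ishomog1 s mdeg ->
  meval (fun i => c * z i) Q = c ^+ s * meval z Q.
Proof.
move=> Qh; rewrite !mevalE mulr_sumr big_seq [RHS]big_seq.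
apply: eq_bigr => m mQ; rewrite mulrCA; congr (_ * _).
rewrite -(dhomogP _ _ _ Qh _ mQ) /= mdegE -prodrXr -big_split /=.
by apply: eq_bigr => i _; rewrite exprMn.
Qed.

End MpolyAlgebra.

Section Homogenize.
Variables (R : comNzRingType) (n N : nat) (L : 'I_N -> mpoly n R).
Variable Y : 'I_N -> 'rV[R]_n.
Hypothesis sumL : \sum_i L i = 1.
Hypothesis sumLY : forall j, \sum_i Y i 0 j *: L i = mvar j.

(** Each coordinate is a linear form in the [L i], and a monomial of degree below k is padded with
    powers of the form [e], which the substitution sends to 1. *)
Lemma homogenize (k : nat) (u : mpoly n R) : (msize u <= k.+1)%N ->
  exists2 p : mpoly N R, p \is ishomog1 k mdeg & msubst L p = u.
Proof.
move=> uk.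
pose e : mpoly N R := \sum_i mvar i.
pose g j : mpoly N R := \sum_i Y i 0 j *: mvar i.
have he : e \is ishomog1 1 mdeg.
  by apply: rpred_sum => i _; rewrite dhomogX /= mdeg1.
have hg j : g j \is ishomog1 1 mdeg.
  by apply: rpred_sum => i _; apply: rpredZ; rewrite dhomogX /= mdeg1.
have Le : msubst L e = 1.
  by rewrite rmorph_sum /= -[RHS]sumL; apply: eq_bigr => i _; rewrite msubstX.
have Lg j : msubst L (g j) = mvar j.
  rewrite linear_sum -[RHS]sumLY /=; apply: eq_bigr => i _.
  by rewrite linearZ /= msubstX.
exists (\sum_(m <- msupp u)
    mcoeff m u *: (e ^+ (k - mdeg m) * \prod_(j < n) g j ^+ m j)).
  rewrite big_seq; apply: rpred_sum => m mu; apply: rpredZ.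
  have mk : (mdeg m <= k)%N by have := msize_mdeg_lt mu; lia.
  have := dhomogM (dhomogMn (k - mdeg m) he)
    (homog_prod_exp predT (fun i => m i) hg).
  by rewrite -mdegE mul1n subnK.
rewrite linear_sum [RHS]mpolyE /=; apply: eq_bigr => m _.
rewrite linearZ /= rmorphM rmorphXn /= Le expr1n mul1r; congr (_ *: _).
rewrite rmorph_prod mpolyXE_id /=; apply: eq_bigr => j _.
by rewrite rmorphXn /= Lg.
Qed.

End Homogenize.

(** * Directional derivatives, Taylor coefficients along a frame, zero tests for polynomials *)

Section Derivatives.
Variable R : realType.

Lemma dirderD (n : nat) (w : 'rV[R]_n) : {morph dirder w : p q / p + q}.
Proof.
move=> p q; rewrite /dirder -big_split; apply: eq_bigr => i _ /=.
by rewrite mderivD scalerDr.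
Qed.

Lemma dirderM (n : nat) (w : 'rV[R]_n) (p q : mpoly n R) :
  dirder w (p * q) = dirder w p * q + p * dirder w q.
Proof.
rewrite /dirder mulr_suml mulr_sumr -big_split; apply: eq_bigr => i _ /=.
by rewrite mderivM scalerDr scalerAl scalerAr.
Qed.

Lemma dirderC (n : nat) (w : 'rV[R]_n) (c : R) : dirder w (mpolyC n c) = 0.
Proof. by rewrite /dirder big1 // => i _; rewrite mderivC scaler0. Qed.

Lemma dirderX (n : nat) (w : 'rV[R]_n) (j : 'I_n) :
  dirder w (mvar j) = mpolyC n (w 0 j).
Proof.
rewrite /dirder (bigD1 j) //= big1 => [|i ij].
  rewrite mderivX mnm1E eqxx scale1r addr0.
  suff -> : mnm_sub (mnm1 j) (mnm1 j) = mnm0.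
    by rewrite mpolyX0 -mul_mpolyC mulr1.
  by apply/mnmP => i; rewrite mnmBE mnm0E subnn.
by rewrite mderivX mnm1E eq_sym (negbTE ij) scale0r scaler0.
Qed.

Lemma dirder_delta (n : nat) (i : 'I_n) (p : mpoly n R) :
  dirder (delta_mx 0 i) p = mderiv i p.
Proof.
rewrite /dirder (bigD1 i) //= big1 => [|j ji].
  by rewrite mxE !eqxx scale1r addr0.
by rewrite mxE (negbTE ji) andbF scale0r.
Qed.

Lemma frame_derD (n q : nat) (W : 'M[R]_(q, n)) (b : multinom q) :
  {morph frame_der W b : p u / p + u}.
Proof.
move=> p u; rewrite /frame_der; elim: (enum 'I_q) p u => [//|i s IH] p u /=.
by rewrite IH; elim: (b i) => //= e ->; rewrite dirderD.
Qed.

Lemma frame_derZ (n q : nat) (W : 'M[R]_(q, n)) (b : multinom q) (c : R)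
    (p : mpoly n R) : frame_der W b (c *: p) = c *: frame_der W b p.
Proof.
have dZ (w : 'rV[R]_n) u : dirder w (c *: u) = c *: dirder w u.
  by rewrite -!mul_mpolyC dirderM dirderC mul0r add0r.
rewrite /frame_der; elim: (enum 'I_q) p => [//|i s IH] p /=.
by rewrite IH; elim: (b i) => //= e ->; rewrite dZ.
Qed.

Lemma frame_der_sum (n q : nat) (W : 'M[R]_(q, n)) (b : multinom q)
    (I : Type) (s : seq I) (c : I -> R) (p : I -> mpoly n R) :
  frame_der W b (\sum_(i <- s) c i *: p i) =
  \sum_(i <- s) c i *: frame_der W b (p i).
Proof.
elim: s => [|i s IH]; last by rewrite !big_cons frame_derD frame_derZ IH.
by rewrite !big_nil -(scale0r 0) frame_derZ !scale0r.
Qed.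

Section Taylor.
Variables (n q : nat) (x : 'rV[R]_n) (W : 'M[R]_(q, n)).

(** The j-th coordinate of x + t W with t as variables; substituting it into u gives the Taylor
    expansion of u at x along the rows of W. *)
Definition frame_point (j : 'I_n) : mpoly q R :=
  mpolyC q (x 0 j) + \sum_(i < q) W i j *: mvar i.

Lemma mderiv_frame_point (i : 'I_q) (u : mpoly n R) :
  mderiv i (msubst frame_point u) = msubst frame_point (dirder (row i W) u).
Proof.
elim/mpoly_ring_ind: u => [c|j|p1 p2 IH1 IH2|p1 p2 IH1 IH2].
- by rewrite comp_mpolyC mderivC dirderC -(mpolyC0 n) comp_mpolyC mpolyC0.
- rewrite msubstX dirderX comp_mpolyC mderivD mderivC add0r mxE linear_sum /=.
  rewrite (bigD1 i) //= big1 => [|l li].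
    by rewrite -dirder_delta -!mul_mpolyC dirderM dirderC mul0r add0r addr0
      dirderX mxE !eqxx mpolyC1 mulr1.
  by rewrite -dirder_delta -!mul_mpolyC dirderM dirderC mul0r add0r
      dirderX mxE (negbTE li) andbF mpolyC0 mulr0.
- by rewrite rmorphD /= mderivD dirderD rmorphD /= IH1 IH2.
- by rewrite rmorphM /= mderivM dirderM rmorphD !rmorphM /= IH1 IH2.
Qed.

Lemma mderivm_frame_point (b : multinom q) (u : mpoly n R) :
  mderivm b (msubst frame_point u) = msubst frame_point (frame_der W b u).
Proof.
rewrite /mderivm /frame_der; elim: (enum 'I_q) => [//|i s IH] /=.
by rewrite IH; elim: (b i) => //= e ->; rewrite mderiv_frame_point.
Qed.

Lemma mcoeff0_frame_point (u : mpoly n R) :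
  mcoeff mnm0 (msubst frame_point u) = peval u x.
Proof.
rewrite /peval.
elim/mpoly_ring_ind: u => [c|j|p1 p2 IH1 IH2|p1 p2 IH1 IH2].
- by rewrite comp_mpolyC mevalC mcoeffC eqxx mulr1.
- rewrite msubstX mevalXU mcoeffD mcoeffC eqxx mulr1 linear_sum big1 ?addr0 //=.
  by move=> i _; rewrite mcoeffZ mcoeffX mnm1_eq0 mulr0.
- by rewrite rmorphD /= mcoeffD mevalD IH1 IH2.
- by rewrite rmorphM /= rmorphM mevalM /= IH1 IH2.
Qed.

(** Taylor's formula: the derivative of order b is b! times the coefficient of b. *)
Lemma peval_frame_der (b : multinom q) (u : mpoly n R) :
  peval (frame_der W b u) x =
  mcoeff b (msubst frame_point u) *+ \prod_(i < q) (b i)`!.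
Proof.
rewrite -mcoeff0_frame_point -mderivm_frame_point mcoeff_mderivm addm0.
by congr (_ *+ _); apply: eq_bigr => i _; rewrite ffactnn.
Qed.

Lemma peval_frame_der_eq0 (b : multinom q) (u : mpoly n R) :
  peval (frame_der W b u) x = 0 <-> mcoeff b (msubst frame_point u) = 0.
Proof.
rewrite peval_frame_der; split=> [/eqP|->]; last by rewrite mul0rn.
rewrite mulrn_eq0 => /orP[|/eqP//].
by rewrite eqn0Ngt prodn_gt0 // => i; apply: fact_gt0.
Qed.

End Taylor.

Lemma frame_der1 (n : nat) (b : multinom n) (p : mpoly n R) :
  frame_der 1%:M b p = mderivm b p.
Proof.
rewrite /mderivm /frame_der; elim: (enum 'I_n) => [//|i s IH] /=.
by rewrite IH; elim: (b i) => //= e ->; rewrite row1 dirder_delta.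
Qed.

Section Line.
Variables (n : nat) (x y : 'rV[R]_n).

Definition line_poly : mpoly n R -> {poly R} :=
  mmap (@polyC R) (fun j => (x 0 j)%:P + y 0 j *: 'X).

Lemma line_polyE (p : mpoly n R) (t : R) :
  (line_poly p).[t] = peval p (x + t *: y).
Proof.
rewrite /line_poly /peval.
elim/mpoly_ring_ind: p => [c|j|p1 p2 IH1 IH2|p1 p2 IH1 IH2].
- by rewrite mmapC hornerC mevalC.
- by rewrite mmapX mmap1U mevalXU !mxE !hornerE mulrC.
- by rewrite mmapD mevalD hornerD IH1 IH2.
- by rewrite rmorphM mevalM hornerM IH1 IH2.
Qed.

Lemma deriv_line_poly (p : mpoly n R) :
  (line_poly p)^`() = line_poly (dirder y p).
Proof.
rewrite /line_poly.
elim/mpoly_ring_ind: p => [c|j|p1 p2 IH1 IH2|p1 p2 IH1 IH2].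
- by rewrite mmapC dirderC derivC -(mpolyC0 n) mmapC.
- rewrite mmapX mmap1U dirderX mmapC derivD derivC derivZ derivX add0r.
  by rewrite alg_polyC.
- by rewrite dirderD !mmapD derivD IH1 IH2.
- by rewrite dirderM mmapD !rmorphM derivM /= IH1 IH2.
Qed.

End Line.

Lemma poly_eq0_pos (p : {poly R}) (a b : R) : a < b ->
  (forall t, a < t -> t < b -> p.[t] = 0) -> p = 0.
Proof.
move=> ab p0; apply/eqP; apply/negPn/negP => pN0.
(* Infinitely many distinct points of the open interval; the denominator starts at 2 to stay
   strictly below b. *)
pose g (i : nat) := a + (b - a) / i.+2%:R.
have ba : 0 < b - a by rewrite subr_gt0.
have g_inj : injective g.
  move=> i j /addrI /(mulfI (lt0r_neq0 ba)) /invr_inj /eqP.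
  by rewrite eqr_nat => /eqP [].
have := max_poly_roots pN0 (rs := [seq g i | i <- iota 0 (size p)]).
rewrite (map_inj_uniq g_inj) iota_uniq size_map size_iota ltnn => H.
suff : false by []. 
apply: H => //; apply/allP => _ /mapP[i _ ->]; apply/eqP/p0.
  by rewrite ltrDl divr_gt0.
rewrite -ltrBrDl ltr_pdivrMr // ltr_pMr //.
by rewrite ltr1n.
Qed.

Lemma peval_row (n : nat) (p : mpoly n R) (t : 'I_n -> R) :
  peval p (\row_i t i) = meval t p.
Proof. by apply: meval_eq => i; rewrite mxE. Qed.

(** Moving forward along a coordinate axis stays in the positive orthant, so the partial derivatives
    vanish there too; by induction on the degree they are zero, and p is constant. *)
Lemma mpoly_eq0_pos (n : nat) (p : mpoly n R) :
  (forall t : 'I_n -> R, (forall i, 0 < t i) -> meval t p = 0) -> p = 0.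
Proof.
move: {2}(msize p) (leqnn (msize p)) => N; elim: N p => [|N IH] p.
  by rewrite leqn0 msize_poly_eq0 => /eqP.
move=> pN p0.
have dp0 i : mderiv i p = 0.
  apply: IH => [|t t0].
    rewrite /mmeasure big_seq; elim/big_ind: _ => [//|a b aN bN|m].
      by rewrite geq_max aN.
    rewrite mcoeff_msupp mcoeff_mderiv => mp.
    have : mnm_add m (mnm1 i) \in msupp p.
      by rewrite mcoeff_msupp; apply: contraNneq mp => ->; rewrite mul0rn.
    by move=> /msize_mdeg_lt/leq_trans/(_ pN); rewrite mdegD mdeg1 addn1 ltnS.
  have L0 : line_poly (\row_j t j) (delta_mx 0 i) p = 0.
    apply: (@poly_eq0_pos _ 0 1) => // s s0 _.
    rewrite line_polyE; apply: p0 => j; rewrite !mxE ltr_wpDr //.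
    by rewrite mulr_ge0 ?ler0n ?ltW.
  have := line_polyE (\row_j t j) (delta_mx 0 i) (mderiv i p) 0.
  rewrite -{1}dirder_delta -deriv_line_poly L0 deriv0 horner0 scale0r addr0.
  by rewrite peval_row.
have pE : p = mpolyC n (mcoeff mnm0 p).
  apply/mpolyP => m; rewrite mcoeffC.
  have [<-|m0] := eqVneq mnm0 m; first by rewrite mulr1.
  have [i mi] : exists i, m i != 0%N.
    apply/existsP; apply: contraNT m0; rewrite negb_exists => /forallP m0.
    by apply/eqP/mnmP => i; rewrite mnm0E; have := m0 i; case: (m i).
  rewrite mulr0; have := dp0 i => /(congr1 (mcoeff (mnm_sub m (mnm1 i)))).
  rewrite mcoeff_mderiv mcoeff0.
  suff -> : mnm_add (mnm_sub m (mnm1 i)) (mnm1 i) = m.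
    by move/eqP; rewrite mulrn_eq0 => /eqP.
  apply/mnmP => j; rewrite mnmDE mnmBE mnm1E subnK //.
  by case: eqVneq => // <-; rewrite lt0n.
have := p0 (fun=> 1) (fun=> ltr01); rewrite pE mevalC => ->.
by rewrite mpolyC0.
Qed.

End Derivatives.

(** * Iterated integrals of polynomials *)

Section PolynomialIntegral.
Variable R : realType.
Notation mu := (@lebesgue_measure R).

(** At index 0 the coefficient is a division by zero, hence 0, so this antiderivative vanishes at
    0. *)
Definition antider (p : {poly R}) : {poly R} :=
  \poly_(i < (size p).+1) (p`_i.-1 / i%:R).

Lemma deriv_antider (p : {poly R}) : (antider p)^`() = p.
Proof.
apply/polyP => i; rewrite coef_deriv coef_poly /= ltnS.
have [ip|pi] := ltnP i (size p); last by rewrite mul0rn nth_default.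
by rewrite -[LHS]mulr_natr mulfVK // pnatr_eq0.
Qed.

Lemma antider0 (p : {poly R}) : (antider p).[0] = 0.
Proof. by rewrite horner_coef0 coef_poly /= invr0 mulr0. Qed.

Lemma integral_poly (p q : {poly R}) (c : R) : 0 <= c -> q^`() = p ->
  \int[mu]_(t in `[0, c]) p.[t] = q.[c] - q.[0].
Proof.
rewrite le_eqVlt => /predU1P[<- _|c0 qp].
  by rewrite set_itv1 Rintegral_set1 subrr.
rewrite /Rintegral (@continuous_FTC2 _ (horner p) (horner q)) //.
- by apply: continuous_subspaceT => x; apply: continuous_horner.
- split.
  + by move=> x _; apply: derivable_horner.
  + exact/cvg_at_right_filter/continuous_horner.
  + exact/cvg_at_left_filter/continuous_horner.
- by move=> x _; rewrite -derivE qp.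
Qed.

Lemma integrable_poly (p : {poly R}) (c : R) :
  mu.-integrable `[0, c] (EFin \o horner p).
Proof.
apply: continuous_compact_integrable; first exact: segment_compact.
by apply: continuous_subspaceT => x; apply: continuous_horner.
Qed.

(** The antiderivative is nondecreasing on the interval and has equal end values, so it is constant
    there, hence constant as a polynomial. *)
Lemma integral_poly_eq0 (p : {poly R}) (c : R) : 0 < c ->
  (forall t, 0 <= t <= c -> 0 <= p.[t]) ->
  \int[mu]_(t in `[0, c]) p.[t] = 0 -> p = 0.
Proof.
move=> c0 p0; have dq := deriv_antider p; set q := antider p in dq.
rewrite (integral_poly (ltW c0) dq) => /eqP; rewrite subr_eq0 => /eqP qc.
have q_le t s : 0 <= t -> t <= s -> s <= c -> q.[t] <= q.[s].
  move=> t0 ts sc; rewrite -subr_ge0.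
  (* Shifting by t makes q(s) - q(t) an integral that starts at 0. *)
  have dq' : (q \Po (t%:P + 'X))^`() = p \Po (t%:P + 'X).
    by rewrite deriv_comp dq derivD derivC derivX add0r mulr1.
  have ts0 : 0 <= s - t by rewrite subr_ge0.
  have := integral_poly ts0 dq'.
  rewrite !horner_comp !hornerD !hornerC !hornerX addr0 (addrC t) subrK => <-.
  apply: Rintegral_ge0 => x /=; rewrite in_itv /= => /andP[x0 xs].
  by rewrite horner_comp !hornerE; apply: p0; lra.
suff /(congr1 (@deriv _)) : q - q.[0]%:P = 0.
  by rewrite derivB derivC deriv0 subr0 dq.
apply: (poly_eq0_pos c0) => t t0 tc; apply/eqP; rewrite !hornerE subr_eq0.
by rewrite eq_le -{1}qc !q_le // ltW.
Qed.

(** The outer variable of [H] stands for c, the inner one for t. The integrand of an iterated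
    integral depends on c itself, through the size c - t of the slice. *)
Lemma integral_bipoly (H : {poly {poly R}}) :
  exists P : {poly R}, forall c, 0 <= c ->
    \int[mu]_(t in `[0, c]) H.[c%:P].[t] = P.[c].
Proof.
exists (\sum_(j < size H) antider H`_j * 'X^j) => c c0.
rewrite (@integral_poly _ (\sum_(j < size H) c ^+ j *: antider H`_j)) //.
  rewrite !horner_sum -sumrB; apply: eq_bigr => j _.
  by rewrite !hornerE antider0 mulr0 subr0 mulrC.
rewrite (raddf_sum (@deriv R)) horner_coef /=; apply: eq_bigr => j _.
by rewrite derivZ deriv_antider -polyC_exp mulrC mul_polyC.
Qed.

(* Polynomial functions of l variables, presented as polynomials in the first
   variable so that they follow the recursion of ref_simplex_int. *)
Fixpoint polyfun (l : nat) : ('rV[R]_l -> R) -> Prop :=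
  match l with
  | 0%N => fun=> True
  | l'.+1 => fun g => exists (d : nat) (h : nat -> 'rV[R]_l' -> R),
      (forall i, polyfun (h i)) /\
      forall t u, g (row_mx t%:M u) = \sum_(i < d) t ^+ i * h i u
  end.

Lemma polyfun0 (l : nat) : polyfun (fun _ : 'rV[R]_l => 0).
Proof.
elim: l => [//|l IH] /=; exists 0%N, (fun _ _ => 0); split => // t u.
by rewrite big_ord0.
Qed.

Lemma polyfun_lin (l : nat) (a : R) (g h : 'rV[R]_l -> R) :
  polyfun g -> polyfun h -> polyfun (fun x => a * g x + h x).
Proof.
elim: l g h => [//|l IH] g h [d1 [g' [g'P gE]]] [d2 [h' [h'P hE]]] /=.
(* The families are unconstrained beyond their lengths, so each is cut off to zero there before
   being added. *)
exists (maxn d1 d2), (fun i x => a * (if (i < d1)%N then g' i else fun=> 0) x +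
                      (if (i < d2)%N then h' i else fun=> 0) x).
split=> [i|t u]; first by
  apply: (IH (if _ then _ else _) (if _ then _ else _)); case: ifP => _ //;
  [exact: g'P|exact: polyfun0|exact: h'P|exact: polyfun0].
have pad d (f : nat -> 'rV[R]_l -> R) : (d <= maxn d1 d2)%N ->
    \sum_(i < d) t ^+ i * f i u =
    \sum_(i < maxn d1 d2) t ^+ i * (if (i < d)%N then f i else fun=> 0) u.
  move=> dm; rewrite (@big_ord_widen _ _ _ d (maxn d1 d2)
    (fun i => t ^+ i * f i u) dm).
  rewrite big_mkcond /=; apply: eq_bigr => i _.
  by case: ifP; rewrite ?mulr0.
rewrite gE hE (pad d1) ?leq_maxl // (pad d2) ?leq_maxr // mulr_sumr -big_split.
by apply: eq_bigr => i _; rewrite /= mulrDr mulrCA.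
Qed.

Lemma polyfun_sum (l : nat) (I : Type) (s : seq I) (a : I -> R)
    (g : I -> 'rV[R]_l -> R) :
  (forall i, polyfun (g i)) -> polyfun (fun x => \sum_(i <- s) a i * g i x).
Proof.
move=> gP; elim: s => [|i s IH].
  by under eq_fun do rewrite big_nil; apply: polyfun0.
by under eq_fun do rewrite big_cons; apply: polyfun_lin.
Qed.

Lemma polyfun_monomial (l : nat) (m : 'I_l -> nat) :
  polyfun (fun x => \prod_i x 0 i ^+ m i).
Proof.
elim: l m => [//|l IH] m /=.
exists (m ord0).+1, (fun i => if i == m ord0 then
  fun x : 'rV[R]_l => \prod_j x 0 j ^+ m (lift ord0 j) else fun=> 0).
split=> [i|t u]; first by case: eqP => // _; apply: polyfun0.
rewrite [RHS](bigD1 (ord_max : 'I_(m ord0).+1)) //= eqxx.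
rewrite [X in _ + X]big1 => [|i /negP im]; last first.
  by case: eqP => [iE|_]; [case: im; apply/eqP/val_inj | rewrite mulr0].
rewrite addr0 big_ord_recl; congr (_ ^+ _ * _).
  have -> : ord0 = lshift l (ord0 : 'I_1) by apply: val_inj.
  by apply: etrans (row_mxEl _ _ _ _) _; rewrite mxE eqxx mulr1n.
apply: eq_bigr => j _; congr (_ ^+ _).
have -> : lift ord0 j = rshift 1 j by apply: val_inj.
by apply: etrans (row_mxEr _ _ _ _) _.
Qed.

Lemma polyfun_peval (l : nat) (p : mpoly l R) : polyfun (peval p).
Proof.
rewrite (_ : peval p = fun x =>
  \sum_(m <- msupp p) mcoeff m p * \prod_i x 0 i ^+ m i).
  by apply: polyfun_sum => m; apply: polyfun_monomial.
by apply/funext => x; rewrite /peval mevalE.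
Qed.

(** Both clauses go through one induction on l: polynomial dependence on c needs linearity one
    dimension below, and linearity needs integrability of the inner integrals, which follows from
    their being polynomials. *)
Definition ref_int_spec (l : nat) : Prop :=
  (forall g : 'rV[R]_l -> R, polyfun g -> exists P : {poly R},
     forall c, 0 <= c -> ref_simplex_int c g = P.[c]) /\
  (forall (a c : R) (g h : 'rV[R]_l -> R), polyfun g -> polyfun h -> 0 <= c ->
     ref_simplex_int c (fun x => a * g x + h x) =
     a * ref_simplex_int c g + ref_simplex_int c h).

Lemma ref_int_sum (l : nat) : ref_int_spec l ->
  forall (c : R) (I : Type) (s : seq I) (a : I -> R) (g : I -> 'rV[R]_l -> R),
  (forall i, polyfun (g i)) -> 0 <= c ->
  ref_simplex_int c (fun x => \sum_(i <- s) a i * g i x) =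
  \sum_(i <- s) a i * ref_simplex_int c (g i).
Proof.
move=> [_ lin] c I s a g gP c0; elim: s => [|i s IH].
  rewrite big_nil; under eq_fun do rewrite big_nil.
  (* The integral of 0 is zero by linearity applied to 0 = -1 * 0 + 0. *)
  have := lin (-1) c _ _ (polyfun0 l) (polyfun0 l) c0.
  under eq_fun do rewrite mulr0 addr0.
  by rewrite mulN1r addNr.
under eq_fun do rewrite big_cons.
by rewrite lin ?IH ?big_cons //; apply: polyfun_sum.
Qed.

Lemma inner_bipoly (l : nat) : ref_int_spec l ->
  forall g : 'rV[R]_l.+1 -> R, polyfun g -> exists H : {poly {poly R}},
  forall c t, 0 <= t <= c ->
    ref_simplex_int (c - t) (fun u : 'rV[R]_l => g (row_mx t%:M u)) =
    H.[c%:P].[t].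
Proof.
move=> spec g [d [h [hP gE]]].
have [P PE] := boolp.choice (fun i => spec.1 (h i) (hP i)).
(* This is the sum of the t^i P_i(c - t), where ['X] is c and ['X%:P] is t. *)
exists (\sum_(i < d) ('X^i)%:P * (map_poly polyC (P i) \Po ('X - 'X%:P))).
move=> c t /andP[t0 tc]; under eq_fun do rewrite gE.
have ct : 0 <= c - t by rewrite subr_ge0.
rewrite (ref_int_sum spec _ (fun i : 'I_d => t ^+ i) (g := fun i => h i)) //;
  last by move=> i; apply: hP.
rewrite !horner_sum; apply: eq_bigr => i _.
rewrite PE // hornerM hornerC hornerM hornerXn horner_comp !hornerE.
congr (_ * _); rewrite -[_.[c%:P - 'X]]/(P i \Po (c%:P - 'X)).
by rewrite horner_comp !hornerE.
Qed.

Lemma ref_intP (l : nat) : ref_int_spec l.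
Proof.
elim: l => [|l IH].
  split=> [g _|//]; exists (g 0)%:P => c _ /=; by rewrite hornerC.
have intE (g : 'rV[R]_l.+1 -> R) (H : {poly {poly R}}) c :
    (forall c t, 0 <= t <= c ->
    ref_simplex_int (c - t) (fun u : 'rV[R]_l => g (row_mx t%:M u)) =
    H.[c%:P].[t]) ->
    ref_simplex_int c g = \int[mu]_(t in `[0, c]) H.[c%:P].[t].
  move=> HE /=; apply: eq_Rintegral => t.
  by rewrite inE /= in_itv /=; apply: HE.
split=> [g gP|a c g h gP hP c0].
  have [H HE] := inner_bipoly IH gP.
  have [P PE] := integral_bipoly H.
  by exists P => c c0; rewrite (intE _ _ _ HE) PE.
have [H HE] := inner_bipoly IH gP.
have [K KE] := inner_bipoly IH hP.
rewrite (intE _ _ _ HE) (intE _ _ _ KE) -RintegralZl //; last first.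
  exact: integrable_poly.
rewrite -RintegralD //; last 2 first.
- have := integrable_poly (a *: H.[c%:P]) c.
  by apply: eq_integrable => // t _ /=; rewrite hornerZ.
- exact: integrable_poly.
apply: eq_Rintegral => t; rewrite inE /= in_itv /= => /[dup] tc /andP[t0 tc'].
rewrite -HE // -KE //.
apply: (IH.2 a (c - t) (fun u => g (row_mx t%:M u))
  (fun u => h (row_mx t%:M u))); last by rewrite subr_ge0.
- by case: gP => d [g' [g'P gE]]; under eq_fun do rewrite gE;
    apply: polyfun_sum => i; apply: g'P.
- by case: hP => d [g' [g'P gE]]; under eq_fun do rewrite gE;
    apply: polyfun_sum => i; apply: g'P.
Qed.

Lemma ref_int_ge0 (l : nat) (c : R) (g : 'rV[R]_l -> R) :
  (forall x, 0 <= g x) -> 0 <= ref_simplex_int c g.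
Proof.
elim: l c g => [|l IH] c g g0 /=; first exact: g0.
by apply: Rintegral_ge0 => t _; apply: IH.
Qed.

(** The outer integrand is a nonnegative polynomial with zero integral, so every slice has zero
    integral, and the induction applies in the slice through x. The strict bound on the sum keeps
    the slice size c - t positive. *)
Lemma ref_int_eq0 (l : nat) (c : R) (g : 'rV[R]_l -> R) :
  polyfun g -> (forall x, 0 <= g x) -> 0 < c -> ref_simplex_int c g = 0 ->
  forall x : 'rV[R]_l, (forall i, 0 <= x 0 i) -> \sum_i x 0 i < c -> g x = 0.
Proof.
elim: l c g => [|l IH] c g gP g0 c0.
  by move=> /= gz x _ _; rewrite (thinmx0 x).
have [H HE] := inner_bipoly (ref_intP l) gP.
move=> int0 x x0 xc.
have Hz : H.[c%:P] = 0.
  apply: (integral_poly_eq0 c0) => [t tc|].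
    by rewrite -HE //; apply: ref_int_ge0.
  rewrite -[RHS]int0 /=; apply: eq_Rintegral => t.
  by rewrite inE /= in_itv /= => tc; rewrite HE.
pose t := x 0 0; pose u : 'rV[R]_l := rsubmx (x : 'rV_(1 + l)).
have xE : x = row_mx t%:M u.
  apply: etrans (esym (hsubmxK (x : 'rV_(1 + l)))) _; congr (row_mx _ _).
  apply/matrixP => i j; rewrite !ord1 !mxE eqxx mulr1n; congr (x _ _).
  exact: val_inj.
have uE i : u 0 i = x 0 (lift ord0 i).
  by rewrite mxE; congr (x _ _); apply: val_inj.
move: xc; rewrite big_ord_recl -/t => xc.
have su : \sum_i u 0 i < c - t.
  by rewrite ltrBrDl; under eq_bigr do rewrite uE.
have u0 i : 0 <= u 0 i by rewrite uE.
have su0 : 0 <= \sum_i u 0 i by apply: sumr_ge0.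
rewrite xE; apply: (IH (c - t) (fun u => g (row_mx t%:M u))) => //.
- by case: gP => d [g' [g'P gE]]; under eq_fun do rewrite gE;
    apply: polyfun_sum => i; apply: g'P.
- exact: le_lt_trans su.
- rewrite HE ?Hz ?horner0 // x0 /=; lra.
Qed.

End PolynomialIntegral.

(** * Pasting polynomials into a C^m function *)

Section SmoothPasting.
Variables (R : realType) (n : nat).
Implicit Types (p : mpoly n R) (x : 'rV[R]_n).

Lemma continuous_peval p : continuous (peval p : 'rV[R]_n -> R^o).
Proof.
elim/mpoly_ring_ind: p => [c|i|p1 p2 IH1 IH2|p1 p2 IH1 IH2] x.
- rewrite (_ : peval _ = cst c); first exact: cst_continuous.
  by apply/funext => y; rewrite /peval mevalC.
- rewrite (_ : peval _ = fun y : 'rV[R]_n => y 0 i).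
    exact: coord_continuous.
  by apply/funext => y; rewrite /peval mevalXU.
- rewrite (_ : peval _ = peval p1 \+ peval p2).
    by apply: continuousD; [apply: IH1|apply: IH2].
  by apply/funext => y; rewrite /peval mevalD.
- rewrite (_ : peval _ = peval p1 \* peval p2).
    by apply: continuousM; [apply: IH1|apply: IH2].
  by apply/funext => y; rewrite /peval mevalM.
Qed.

Definition diff_quot (f : 'rV[R]_n -> R^o) x (v : 'rV[R]_n) (h : R) : R^o :=
  h^-1 *: (f (h *: v + x) - f x).

Lemma cvg_diff_quot_peval p x (i : 'I_n) :
  diff_quot (peval p) x (delta_mx 0 i) @ 0^' --> (peval (mderiv i p) x : R^o).
Proof.
pose q := line_poly x (delta_mx 0 i) p.
have [dq vq] := is_derive_poly q 0.
have := dq; rewrite /derivable.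
rewrite -[peval (mderiv i p) x](_ : 'D_1 (horner q) 0 = _); last first.
  by rewrite vq deriv_line_poly dirder_delta line_polyE scale0r addr0.
rewrite /derive.
rewrite (_ : (fun h => h^-1 *: _) = diff_quot (peval p) x (delta_mx 0 i)) //.
apply/funext => h; rewrite /diff_quot; congr (_ *: (_ - _)).
  by rewrite /= line_polyE addr0 [h *: 1]mulr1 addrC.
by rewrite line_polyE scale0r addr0.
Qed.

Section Paste.
Variables (I : finType) (Th : {set I}) (K : I -> set 'rV[R]_n).
Variable Omega : set 'rV[R]_n.
Hypothesis Kclosed : forall i, i \in Th -> closed (K i).
Hypothesis Oopen : open Omega.
Hypothesis Ocover : forall x, Omega x -> exists2 i, i \in Th & K i x.

(** The cells are closed and finitely many, so those that miss x miss a neighbourhood of x. *)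
Lemma near_cells x : Omega x ->
  \forall y \near x, Omega y /\ forall i, i \in Th -> K i y -> K i x.
Proof.
move=> Ox; apply: filterI; first exact: open_nbhs_nbhs.
apply: (@filter_forall _ I (fun i y => i \in Th -> K i y -> K i x) (nbhs x) _) => i.
have [Kx|nKx] := pselect (i \in Th -> K i x).
  by apply: nearW => y /Kx.
have iT : i \in Th by apply: contrapT => iT; apply: nKx.
have : \forall y \near x, (~` K i) y.
  apply: open_nbhs_nbhs; split; first exact/closed_openC/Kclosed.
  by move=> Kx; apply: nKx.
by apply: filterS => y nKy _ /nKy.
Qed.

Variables (p : I -> mpoly n R) (v : 'rV[R]_n -> R^o).
Hypothesis vE : forall i x, Omega x -> i \in Th -> K i x -> v x = peval (p i) x.

Lemma paste_continuous x : Omega x -> {for x, continuous v}.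
Proof.
move=> Ox; apply/(@cvgrPdist_lt _ R^o _ (nbhs x) (nbhs_filter x)) => e e0.
have : \forall y \near x, forall i, `|peval (p i) x - peval (p i) y| < e.
  apply: (@filter_forall _ I
    (fun i y => `|peval (p i) x - peval (p i) y| < e) (nbhs x) _) => i.
  by have /(@cvgrPdist_lt _ R^o _ (nbhs x) (nbhs_filter x)) :=
    @continuous_peval (p i) x; apply.
apply: filterS2 (near_cells Ox) => y [Oy Ky] py.
have [i iT Kiy] := Ocover Oy.
by rewrite (vE Oy iT Kiy) (vE Ox iT) ?py //; apply: Ky.
Qed.

(** Along the line through x the cell may change with h. The polynomials of all cells at x share the
    derivative L, so a bound uniform over these finitely many cells is enough. *)
Lemma paste_derive x (j : 'I_n) (L : R) : Omega x ->
  (forall i, i \in Th -> K i x -> peval (mderiv j (p i)) x = L) ->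
  derivable v x (delta_mx 0 j) /\ 'D_(delta_mx 0 j) v x = L.
Proof.
move=> Ox dL.
suff vL : diff_quot v x (delta_mx 0 j) @ 0^' --> (L : R^o).
  by split; [apply: cvgP vL|apply: cvg_lim vL].
apply/cvgrPdist_lt => e e0.
have : \forall h \near 0^', forall i, i \in Th -> K i x ->
    `|L - diff_quot (peval (p i)) x (delta_mx 0 j) h| < e.
  apply: (@filter_forall _ I (fun i h => i \in Th -> K i x ->
    `|L - diff_quot (peval (p i)) x (delta_mx 0 j) h| < e) (0 : R)^' _) => i.
  have [[iT Kx]|nK] := pselect (i \in Th /\ K i x); last first.
    by apply: nearW => h iT Kx; case: nK.
  have /cvgrPdist_lt/(_ _ e0) := @cvg_diff_quot_peval (p i) x j.
  by rewrite (dL _ iT Kx); apply: filterS => h.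
have : \forall h \near (0 : R)^', Omega (h *: delta_mx 0 j + x) /\
    forall i, i \in Th -> K i (h *: delta_mx 0 j + x) -> K i x.
  have cv : (fun h : R => h *: delta_mx 0 j + x) @ (0 : R)^' --> x.
    rewrite -[X in _ --> X]add0r -(scale0r (delta_mx 0 j : 'rV[R]_n)).
    apply: cvgD; last exact: cvg_cst.
    apply: cvgZr_tmp.
    exact: cvg_within.
  exact: (cv _ (near_cells Ox)).
apply: filterS2 => h [Oy Ky] dh.
have [i iT Kiy] := Ocover Oy; have Kix := Ky _ iT Kiy.
by rewrite /diff_quot (vE Oy iT Kiy) (vE Ox iT Kix); apply: dh.
Qed.

End Paste.

(** The induction is on the number e of derivatives still to take, for any function v that is
    cellwise the g-th derivative; its partial derivatives are of the same kind with g increased by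
    one. *)
Lemma classC_paste (I : finType) (Th : {set I}) (K : I -> set 'rV[R]_n)
    (Omega : set 'rV[R]_n) (p : I -> mpoly n R) (m : nat) :
  (forall i, i \in Th -> closed (K i)) -> open Omega ->
  (forall x, Omega x -> exists2 i, i \in Th & K i x) ->
  (forall (g : multinom n) i j x, (mdeg g <= m)%N -> i \in Th -> j \in Th ->
     K i x -> K j x -> peval (mderivm g (p i)) x = peval (mderivm g (p j)) x) ->
  forall (e : nat) (g : multinom n) (v : 'rV[R]_n -> R^o),
    (mdeg g + e <= m)%N ->
    (forall i x, Omega x -> i \in Th -> K i x ->
       v x = peval (mderivm g (p i)) x) ->
    classC e Omega v.
Proof.
move=> Kc Oo Oc match_ e; elim: e => [|e IH] g v gm vE.
  by split=> // x Ox; apply: (paste_continuous Kc Oo Oc vE).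
split=> [x Ox|j]; first exact: (paste_continuous Kc Oo Oc vE).
have ge : (mdeg (mnm_add g (mnm1 j)) + e <= m)%N.
  by rewrite mdegD mdeg1 addn1 addSnnS.
have dE i x : Omega x -> i \in Th -> K i x ->
    derivable v x (delta_mx 0 j) /\ 'D_(delta_mx 0 j) v x =
    peval (mderivm (mnm_add g (mnm1 j)) (p i)) x.
  move=> Ox iT Kx; apply: (paste_derive Kc Oo Oc vE) => // i' i'T Kx'.
  rewrite -mderivmU1m -mderivmDm; apply: match_ => //.
  exact: leq_trans (leq_addr _ _) ge.
split=> [x Ox|].
  by have [i iT Kx] := Oc x Ox; have [] := dE i x Ox iT Kx.
by apply: (IH _ _ ge) => i x Ox iT Kx; have [] := dE i x Ox iT Kx.
Qed.

End SmoothPasting.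

(** * Integrals over a face *)

Section Gram.
Variable R : realType.

Lemma sqr_norm_ge0 (n : nat) (u : 'rV[R]_n) : 0 <= (u *m u^T) 0 0.
Proof. by rewrite mxE sumr_ge0 // => i _; rewrite mxE -expr2 sqr_ge0. Qed.

Lemma sqr_norm_eq0 (n : nat) (u : 'rV[R]_n) : (u *m u^T) 0 0 = 0 -> u = 0.
Proof.
rewrite mxE => /eqP; rewrite psumr_eq0 => [/allP u0|i _]; last first.
  by rewrite mxE -expr2 sqr_ge0.
apply/rowP => i; have := u0 i (mem_index_enum i).
by rewrite !mxE /= -expr2 sqrf_eq0 => /eqP.
Qed.

(* The segment from the identity to the Gram matrix stays inside the invertible
   matrices, so the determinant keeps the sign it has at the identity. *)
Lemma gram_det_gt0 (q n : nat) (E : 'M[R]_(q, n)) :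
  row_free E -> 0 < \det (E *m E^T).
Proof.
move=> Efree.
pose M (G : 'M[R]_q) : 'M[{poly R}]_q :=
  (1 - 'X)%:M + 'X *: map_mx polyC G.
have ME G t : (\det (M G)).[t] = \det ((1 - t)%:M + t *: G).
  rewrite -[LHS]/(horner_eval t (\det (M G))) -det_map_mx; congr (\det _).
  apply/matrixP => i j; rewrite mxE /M !mxE -[LHS]/(horner _ t) hornerD hornerMn.
  by rewrite !hornerE.
have {}ME := ME (E *m E^T); set D : {poly R} := \det (M _) in ME.
have Mn0 t : 0 <= t <= 1 -> ~~ root D t.
  move=> /andP[t0 t1]; rewrite /root ME; apply/negP => /det0P[v vn0].
  rewrite mulmxDr mul_mx_scalar -scalemxAr mulmxA => v0.
  (* A kernel vector v would satisfy (1 - t)|v|^2 + t|v E|^2 = 0, a sum of two nonnegative terms. *)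
  have := congr1 (fun A : 'rV_q => (A *m v^T) 0 0) v0.
  rewrite mulmxDl -!scalemxAl -!mulmxA -trmx_mul mulmxA mul0mx.
  rewrite [in LHS]mxE [X in X + _]mxE [X in _ + X]mxE [RHS]mxE => /eqP.
  rewrite paddr_eq0 ?mulr_ge0 ?sqr_norm_ge0 ?subr_ge0 //.
  rewrite !mulf_eq0 => /andP[/orP[t1'|/eqP/sqr_norm_eq0 vz]]; last first.
    by rewrite vz eqxx in vn0.
  case/orP=> [t0'|/eqP/sqr_norm_eq0 vE]; first by lra.
  case/negP: vn0; apply/eqP; apply: (row_free_inj Efree).
  by rewrite mul0mx.
have M0 : D.[0] = 1 by rewrite ME subr0 scale0r addr0 det1.
have M1 : D.[1] = \det (E *m E^T).
  by rewrite ME subrr scale1r raddf0 add0r.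
rewrite -M1 lt_def; apply/andP; split.
  by have := Mn0 1; rewrite ler01 lexx /root => ->.
rewrite leNgt; apply/negP => M1lt0.
(* [poly_ivt] expects a sign change from nonpositive to nonnegative, hence - D. *)
have [|t /andP[t0 t1]] := @poly_ivt _ (- D) 0 1 ler01.
  by rewrite !hornerN M0 oppr_cp0 ler01 oppr_ge0 ltW.
by rewrite rootN; apply/negP/Mn0; rewrite t0.
Qed.

End Gram.

Section FaceIntegral.
Variables (R : realType) (n : nat) (V : finType) (X : V -> 'rV[R]_n).
Implicit Types (f T : {set V}) (x : 'rV[R]_n) (w : V -> R).

Lemma sum_sub_face f T (M : nmodType) (F : V -> M) : f \subset T ->
  (forall i, i \notin f -> F i = 0) -> \sum_(i in T) F i = \sum_(i in f) F i.
Proof.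
move=> fT F0; rewrite (big_setID f) /= (finset.setIidPr fT).
rewrite [X in _ + X]big1 ?addr0 // => j.
by rewrite inE => /andP[/F0].
Qed.

Lemma affinely_independent_sub f T : f \subset T ->
  affinely_independent X T -> affinely_independent X f.
Proof.
move=> fT indT w w0 wX i fi.
pose w' j := if j \in f then w j else 0.
have w'E j : j \in f -> w' j = w j by rewrite /w' => ->.
have w'0 j : j \notin f -> w' j = 0 by rewrite /w' => /negbTE ->.
rewrite -w'E //; apply: indT; last exact: (fintype.subsetP fT).
  by rewrite (sum_sub_face fT) // -[RHS]w0; apply: eq_bigr.
rewrite (sum_sub_face fT) => [|j /w'0 ->]; last exact: scale0r.
by rewrite -[RHS]wX; apply: eq_bigr => j /w'E ->.
Qed.

Lemma bary_coords_sub f T x w : f \subset T ->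
  bary_coords X f x w -> bary_coords X T x w.
Proof.
move=> fT [wN w1 wX]; split.
- by move=> i iT; apply: wN; apply: contra iT; apply: (fintype.subsetP fT).
- by rewrite (sum_sub_face fT).
- by rewrite (sum_sub_face fT) // => i /wN ->; rewrite scale0r.
Qed.

Definition edges (v0 : V) (s : seq V) : 'M[R]_(size s, n) :=
  \matrix_(j < size s) (X (nth v0 s j) - X v0).

Section Enum.
Variables (f : {set V}) (v0 : V) (s : seq V).
Hypothesis fE : enum f = v0 :: s.

Lemma sum_face (M : nmodType) (F : V -> M) :
  \sum_(i in f) F i = F v0 + \sum_(j < size s) F (nth v0 s j).
Proof. by rewrite -big_enum fE big_cons (big_nth v0) big_mkord. Qed.

Lemma mem_face i : (i \in f) = (i == v0) || (i \in s).
Proof. by rewrite -mem_enum fE inE. Qed.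

Lemma face_uniq : (v0 \notin s) && uniq s.
Proof. by have := enum_uniq f; rewrite fE. Qed.

(** Weights on f of total c with edge coordinates t: c = 1 gives barycentric coordinates of points,
    c = 0 gives the weights that turn affine independence into independence of the edges. *)
Definition edge_coord (c : R) (t : 'rV[R]_(size s)) (i : V) : R :=
  (if i == v0 then c - \sum_j t 0 j else 0) +
  \sum_(j < size s | nth v0 s j == i) t 0 j.

Lemma edge_coord_v0 c t : edge_coord c t v0 = c - \sum_j t 0 j.
Proof.
rewrite /edge_coord eqxx [X in _ + X]big1 ?addr0 // => j /eqP jv0.
by have /andP[/negP[]] := face_uniq; rewrite -jv0 mem_nth.
Qed.

Lemma edge_coord_nth c t (j : 'I_(size s)) :
  edge_coord c t (nth v0 s j) = t 0 j.
Proof.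
have /andP[v0s us] := face_uniq.
rewrite /edge_coord ifF; last first.
  by apply: contraNF v0s => /eqP <-; rewrite mem_nth.
rewrite add0r (bigD1 j) //= big1 ?addr0 // => l /andP[/eqP lj /negP[]].
by apply/eqP/val_inj/eqP; rewrite /= -(nth_uniq v0 _ _ us) // lj.
Qed.

Lemma edge_coord_out c t i : i \notin f -> edge_coord c t i = 0.
Proof.
rewrite mem_face negb_or => /andP[/negbTE iv0 is_].
rewrite /edge_coord iv0 add0r big1 // => j /eqP ji.
by rewrite -ji mem_nth in is_.
Qed.

Lemma sum_edge_coord c t : \sum_(i in f) edge_coord c t i = c.
Proof.
rewrite sum_face edge_coord_v0.
by under [X in _ + X]eq_bigr do rewrite edge_coord_nth; rewrite subrK.
Qed.

Lemma sum_edge_coordX c t :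
  \sum_(i in f) edge_coord c t i *: X i = c *: X v0 + t *m edges v0 s.
Proof.
rewrite sum_face edge_coord_v0 mulmx_sum_row.
under [X in _ + X = _]eq_bigr do rewrite edge_coord_nth.
rewrite scalerBl -addrA; congr (_ + _).
under [in RHS]eq_bigr do rewrite rowK scalerBr.
by rewrite sumrB scaler_suml addrC.
Qed.

Lemma edges_row_free : affinely_independent X f -> row_free (edges v0 s).
Proof.
move=> ind; rewrite -kermx_eq0; apply/eqP/row_matrixP => i; rewrite row0.
set t := row i _; have tE : t *m edges v0 s = 0.
  by apply/eqP; rewrite -sub_kermx row_sub.
apply/rowP => j; rewrite [RHS]mxE -(edge_coord_nth 0 t).
apply: ind; rewrite ?sum_edge_coord ?sum_edge_coordX ?scale0r ?tE ?addr0 //.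
by rewrite mem_face mem_nth ?orbT.
Qed.

Lemma bary_coords_edges t :
  bary_coords X f (X v0 + t *m edges v0 s) (edge_coord 1 t).
Proof.
split; [exact: edge_coord_out|exact: sum_edge_coord|].
by rewrite sum_edge_coordX scale1r.
Qed.

Lemma bary_coords_point x w : bary_coords X f x w ->
  x = X v0 + (\row_j w (nth v0 s j)) *m edges v0 s.
Proof.
move=> [_ w1 <-]; have [_ _ <-] := bary_coords_edges (\row_j w (nth v0 s j)).
apply: eq_bigr => i; rewrite mem_face => /orP[/eqP->|/(nthP v0)[j js <-]].
  rewrite edge_coord_v0 -w1 sum_face; congr (_ *: _).
  by under [X in _ = _ - X]eq_bigr do rewrite mxE; rewrite addrK.
by rewrite (edge_coord_nth _ _ (Ordinal js)) mxE.
Qed.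

Lemma simplex_intE (g : 'rV[R]_n -> R) : simplex_int X f g =
  Num.sqrt (\det (edges v0 s *m (edges v0 s)^T)) *
  ref_simplex_int 1 (fun t : 'rV[R]_(size s) => g (X v0 + t *m edges v0 s)).
Proof. by rewrite /simplex_int fE. Qed.

Lemma peval_edges (p : mpoly n R) (t : 'rV[R]_(size s)) :
  peval p (X v0 + t *m edges v0 s) =
  peval (msubst (frame_point (X v0) (edges v0 s)) p) t.
Proof.
rewrite /peval meval_msubst; apply: meval_eq => j.
rewrite mevalD mevalC mxE [X in _ + X]mxE; congr (_ + _).
rewrite raddf_sum; apply: eq_bigr => i _.
by rewrite /= mevalZ mevalXU mulrC.
Qed.

End Enum.

Lemma face_enum f : f != finset.set0 -> exists v0 s, enum f = v0 :: s.
Proof.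
case/finset.set0Pn => x; rewrite -mem_enum.
by case: (enum f) => // v0 s _; exists v0, s.
Qed.

Lemma eq_simplex_int f (g h : 'rV[R]_n -> R) :
  (forall x w, bary_coords X f x w -> g x = h x) ->
  simplex_int X f g = simplex_int X f h.
Proof.
move=> gh; rewrite /simplex_int; case fE: (enum f) => [//|v0 s].
congr (_ * ref_simplex_int _ _); apply/funext => t.
exact: gh (bary_coords_edges fE t).
Qed.

Lemma simplex_int_sum f (I : Type) (r : seq I) (c : I -> R)
    (p : I -> mpoly n R) :
  simplex_int X f (peval (\sum_(i <- r) c i *: p i)) =
  \sum_(i <- r) c i * simplex_int X f (peval (p i)).
Proof.
have [f0|/face_enum[v0 [s fE]]] := eqVneq f finset.set0.
  by rewrite f0 /simplex_int enum_set0 big1 // => i _; rewrite mulr0.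
under [RHS]eq_bigr do rewrite (simplex_intE fE) mulrCA.
rewrite (simplex_intE fE) -mulr_sumr; congr (_ * _).
rewrite -(ref_int_sum (@ref_intP R (size s))) //; last first.
  move=> i; rewrite (_ : (fun t => _) =
    peval (msubst (frame_point (X v0) (edges v0 s)) (p i))).
    exact: polyfun_peval.
  by apply/funext => t; rewrite peval_edges.
congr ref_simplex_int; apply/funext => t.
rewrite /peval raddf_sum; apply: eq_bigr => i _ /=.
by rewrite mevalZ.
Qed.

(** The surface element is positive because the edges are independent, so the reference integral of
    the square vanishes. Positivity of the weight at [v0] supplies the strict bound needed by
    [ref_int_eq0]. *)
Lemma simplex_int_sqr_eq0 f (p : mpoly n R) :
  f != finset.set0 -> affinely_independent X f ->
  simplex_int X f (peval (p * p)) = 0 ->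
  forall x w, bary_coords X f x w -> (forall i, i \in f -> 0 < w i) ->
    peval p x = 0.
Proof.
move=> /face_enum[v0 [s fE]] ind; rewrite (simplex_intE fE) => /eqP.
rewrite mulf_eq0 sqrtr_eq0 leNgt gram_det_gt0 /=; last exact: edges_row_free fE ind.
move=> /eqP int0 x w xw w0.
rewrite (bary_coords_point fE xw); set t := \row_j _.
pose p' := msubst (frame_point (X v0) (edges v0 s)) p.
have : peval (p' * p') t = 0.
  apply: (ref_int_eq0 (polyfun_peval (p' * p')) _ ltr01).
  - by move=> y; rewrite /peval mevalM -expr2 sqr_ge0.
  - rewrite -[RHS]int0; congr ref_simplex_int; apply/funext => y.
    by rewrite peval_edges rmorphM.
  - move=> i; rewrite mxE ltW // w0 //.
    by rewrite (mem_face fE) mem_nth ?orbT.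
  - have [_ <- _] := xw; rewrite (sum_face fE).
    under eq_bigr do rewrite mxE.
    by rewrite ltrDr w0 // (mem_face fE) eqxx.
rewrite peval_edges -/p' /peval mevalM => /eqP.
by rewrite mulf_eq0 orbb => /eqP.
Qed.

End FaceIntegral.

(** * Barycentric coordinates of a cell *)

Lemma mpoly_peval_inj (R : realType) (l : nat) (p q : mpoly l R) :
  (forall x, peval p x = peval q x) -> p = q.
Proof.
move=> pq; apply/eqP; rewrite -subr_eq0; apply/eqP/mpoly_eq0_pos => t _.
by rewrite mevalB -!peval_row pq subrr.
Qed.

Section Cell.
Variables (R : realType) (n : nat) (V : finType) (X : V -> 'rV[R]_n).
Variable T : {set V}.
Hypothesis Tn : #|T| = n.+1.
Hypothesis Tind : affinely_independent X T.
Implicit Types (x y : 'rV[R]_n) (i : V).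

Lemma bary_coords_uniq x (w w' : V -> R) :
  bary_coords X T x w -> bary_coords X T x w' -> w =1 w'.
Proof.
move=> [w0 w1 wX] [w'0 w'1 w'X] i.
have [iT|iT] := boolP (i \in T); last by rewrite w0 // w'0.
apply/eqP; rewrite -subr_eq0; apply/eqP.
apply: (Tind (w := fun i => w i - w' i)) => //.
  by rewrite sumrB w1 w'1 subrr.
by under eq_bigr do rewrite scalerBl; rewrite sumrB wX w'X subrr.
Qed.

(** The n edges at a vertex are independent, hence span the whole space, so the choice made in
    [bary] has a witness at every x. *)
Lemma bary_coords_bary x : bary_coords X T x (bary X T x).
Proof.
have T0 : T != finset.set0 by rewrite -card_gt0 Tn.
have [v0 [s TE]] := face_enum T0.
have sn : size s = n by apply/eq_add_S; rewrite -Tn cardE TE.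
have full : row_full (edges X v0 s).
  by rewrite /row_full -[X in _ == X]sn; apply: edges_row_free TE Tind.
have /submxP[t tE] := submx_full (x - X v0) full.
suff ex : [set w | bary_coords X T x w] (edge_coord v0 1 t).
  exact: (xgetPex (fun=> 0) (ex_intro _ _ ex)).
by rewrite /= -(subrK (X v0) x) tE addrC; apply: bary_coords_edges.
Qed.

Lemma bary_eq x w : bary_coords X T x w -> bary X T x =1 w.
Proof. exact: bary_coords_uniq (bary_coords_bary x). Qed.

(** On f the coordinates are the same for every cell containing f, which lets functionals on f be
    compared between cells. *)
Lemma bary_face (f : {set V}) x w :
  f \subset T -> bary_coords X f x w -> bary X T x =1 w.
Proof. by move=> fT /(bary_coords_sub fT)/bary_eq. Qed.

(* The derivative of lambda_i in the direction y. *)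
Definition grad y i : R := bary X T y i - bary X T 0 i.

Lemma gradP y w : (forall i, i \notin T -> w i = 0) ->
  \sum_(i in T) w i = 0 -> \sum_(i in T) w i *: X i = y -> grad y =1 w.
Proof.
move=> wN w0 wX i; have [bN b1 bX] := bary_coords_bary 0.
rewrite /grad (@bary_eq y (fun i => bary X T 0 i + w i)) 1?addrC ?addKr //.
split=> [j jT||].
- by rewrite wN // bN // addr0.
- by rewrite big_split /= w0 b1 addr0.
- by under eq_bigr do rewrite scalerDl; rewrite big_split /= bX wX add0r.
Qed.

Lemma grad_coords y : [/\ forall i, i \notin T -> grad y i = 0,
  \sum_(i in T) grad y i = 0 & \sum_(i in T) grad y i *: X i = y].
Proof.
have [bN b1 bX] := bary_coords_bary 0; have [yN y1 yX] := bary_coords_bary y.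
split=> [i iT||]; first by rewrite /grad bN // yN // subrr.
  by rewrite sumrB b1 y1 subrr.
by under eq_bigr do rewrite scalerBl; rewrite sumrB bX yX subr0.
Qed.

Lemma baryD x y i : bary X T (x + y) i = bary X T x i + grad y i.
Proof.
have [xN x1 xX] := bary_coords_bary x; have [yN y0 yX] := grad_coords y.
apply: (@bary_eq _ (fun i => bary X T x i + grad y i)); split=> [j jT||].
- by rewrite xN // yN // addr0.
- by rewrite big_split /= x1 y0 addr0.
- by under eq_bigr do rewrite scalerDl; rewrite big_split /= xX yX.
Qed.

Lemma grad_sum (I : finType) (c : I -> R) (y : I -> 'rV[R]_n) i :
  grad (\sum_j c j *: y j) i = \sum_j c j * grad (y j) i.
Proof.
apply: (@gradP _ (fun i => \sum_j c j * grad (y j) i)) => [l lT||].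
- by apply: big1 => j _; have [-> //] := grad_coords (y j); rewrite mulr0.
- rewrite exchange_big big1 // => j _; rewrite -mulr_sumr.
  by have [_ -> _] := grad_coords (y j); rewrite mulr0.
- under eq_bigr do rewrite scaler_suml.
  rewrite exchange_big; apply: eq_bigr => j _ /=.
  have [_ _ {2}<-] := grad_coords (y j); rewrite scaler_sumr.
  by apply: eq_bigr => l _; rewrite scalerA.
Qed.

Lemma grad_edge a b i : a \in T -> b \in T ->
  grad (X a - X b) i = (i == a)%:R - (i == b)%:R.
Proof.
move=> aT bT.
have sum1 (M : lmodType R) (F : V -> M) c : c \in T ->
    \sum_(j in T) (j == c)%:R *: F j = F c.
  move=> cT; rewrite (bigD1 c) //= eqxx scale1r big1 ?addr0 // => j /andP[_].
  by move=> /negbTE ->; rewrite scale0r.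
apply: (@gradP _ (fun i => (i == a)%:R - (i == b)%:R)) => [j jT||].
- case: eqP jT => [->|_]; first by rewrite aT.
  by case: eqP => [->|_]; rewrite ?bT // subrr.
- have s1 c : c \in T -> \sum_(j in T) (j == c)%:R = 1 :> R.
    move=> cT; rewrite -[RHS](sum1 R^o (fun=> 1) c cT).
    by apply: eq_bigr => j _; rewrite [RHS]mulr1.
  by rewrite sumrB !s1 // subrr.
- by under eq_bigr do rewrite scalerBl; rewrite sumrB !sum1.
Qed.

Definition bary_poly i : mpoly n R :=
  mpolyC n (bary X T 0 i) + \sum_j grad (delta_mx 0 j) i *: mvar j.

Lemma peval_bary_poly i x : peval (bary_poly i) x = bary X T x i.
Proof.
rewrite /peval mevalD mevalC -[in RHS](add0r x) baryD; congr (_ + _).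
rewrite [in RHS](row_sum_delta x) grad_sum raddf_sum; apply: eq_bigr => j _ /=.
by rewrite mevalZ mevalXU mulrC.
Qed.

Lemma sum_bary_poly : \sum_(i in T) bary_poly i = 1.
Proof.
apply: mpoly_peval_inj => x; have [_ x1 _] := bary_coords_bary x.
rewrite {2}/peval meval1 -[RHS]x1 /peval raddf_sum; apply: eq_bigr => i _.
exact: peval_bary_poly.
Qed.

Lemma sum_bary_polyX j : \sum_(i in T) X i 0 j *: bary_poly i = mvar j.
Proof.
apply: mpoly_peval_inj => x; have [_ _ xX] := bary_coords_bary x.
rewrite [RHS]mevalXU -[in RHS]xX summxE /peval raddf_sum.
apply: eq_bigr => i _; rewrite /= mevalZ mxE mulrC; congr (_ * _).
exact: peval_bary_poly.
Qed.

Lemma bary_poly_frame (q : nat) (W : 'M[R]_(q, n)) x i :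
  msubst (frame_point x W) (bary_poly i) =
  mpolyC q (bary X T x i) + \sum_j grad (row j W) i *: mvar j.
Proof.
apply: mpoly_peval_inj => z; rewrite {1}/peval meval_msubst.
have -> : meval (fun j => meval (z 0) (frame_point x W j)) (bary_poly i) =
    peval (bary_poly i) (x + z *m W).
  apply: meval_eq => j; rewrite mevalD mevalC mxE [in RHS]mxE; congr (_ + _).
  by rewrite raddf_sum; apply: eq_bigr => l _; rewrite /= mevalZ mevalXU mulrC.
rewrite peval_bary_poly baryD /peval mevalD mevalC; congr (_ + _).
rewrite mulmx_sum_row grad_sum raddf_sum; apply: eq_bigr => j _ /=.
by rewrite mevalZ mevalXU mulrC.
Qed.

Lemma simplex_hullE x : simplex_hull X T x <-> forall i, 0 <= bary X T x i.
Proof.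
split=> [[w wx w0] i|b0]; first by rewrite (bary_eq wx).
by exists (bary X T x) => //; apply: bary_coords_bary.
Qed.

Lemma closed_simplex_hull : closed (simplex_hull X T).
Proof.
rewrite (_ : simplex_hull X T =
    \bigcap_(i in [set: V]) (peval (bary_poly i) @^-1` [set t | 0 <= t])).
  apply: closed_bigI => i _; apply: closed_comp; last exact: closed_ge.
  by move=> x _; apply: continuous_peval.
apply/seteqP; split=> x /=.
  by move=> /simplex_hullE b0 i _ /=; rewrite peval_bary_poly.
move=> b0; apply/simplex_hullE => i.
by rewrite -peval_bary_poly; apply: b0.
Qed.

(* The gradients of the barycentric coordinates of the vertices off f vanish
   along f, so they are unchanged by orthogonal projection on the normal plane. *)
Lemma normal_frame_surj (f : {set V}) (q : nat) (W : 'M[R]_(q, n)) :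
  f \subset T -> f != finset.set0 -> normal_frame X f W ->
  forall mu : V -> R, exists z : 'rV[R]_q,
    forall i, i \in T :\: f -> grad (z *m W) i = mu i.
Proof.
move=> fT /face_enum[v0 [s fE]] Wn mu.
have v0f : v0 \in f by rewrite (mem_face fE) eqxx.
have sf (j : 'I_(size s)) : nth v0 s j \in f.
  by rewrite (mem_face fE) mem_nth ?orbT.
have v0T := fintype.subsetP fT _ v0f.
pose E := edges X v0 s; pose G := E *m E^T.
have Gu : G \in unitmx.
  rewrite unitmxE unitfE lt0r_neq0 // gram_det_gt0 //.
  exact: (edges_row_free fE (affinely_independent_sub fT Tind)).
(* Off f the gradient of X j - X v0 is the indicator of j, so [y0] has the prescribed gradients. *)
pose y0 : 'rV[R]_n := \sum_(j : V) (if j \in T :\: f then mu j else 0) *: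
  (if j \in T :\: f then X j - X v0 else 0).
(* The edge coordinates of the orthogonal projection of [y0] on the tangent space of f, by the
   normal equations. *)
pose a := y0 *m E^T *m invmx G.
pose y := y0 - a *m E.
have yE : y *m E^T = 0.
  by rewrite mulmxBl -!mulmxA -/G mulVmx // mulmx1 subrr.
have yX i : i \in f -> y *m (X i - X v0)^T = 0.
  rewrite (mem_face fE) => /orP[/eqP->|/(nthP v0)[j js <-]].
    by rewrite subrr trmx0 mulmx0.
  have := congr1 (fun A : 'rV_(size s) => A 0 (Ordinal js)) yE.
  rewrite mxE [RHS]mxE => yj; apply/matrixP => k l; rewrite !ord1 !mxE -[RHS]yj.
  by apply: eq_bigr => h _; rewrite !mxE.
have /submxP[z zE] : (y <= W)%MS.
  apply/(Wn y) => i j fi fj.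
  have -> : X i - X j = (X i - X v0) - (X j - X v0).
    by rewrite opprB addrA subrK.
  by rewrite linearB mulmxBr !yX ?subrr.
exists z => i iTf; rewrite -zE.
have -> : y = \sum_(j < 2) (if j == 0 then 1 else -1) *:
    (if j == 0 then y0 else a *m E).
  by rewrite !big_ord_recl big_ord0 /= scale1r scaleN1r addr0.
rewrite grad_sum !big_ord_recl big_ord0 /= mul1r addr0.
have -> : grad (a *m E) i = 0.
  rewrite mulmx_sum_row grad_sum big1 // => j _.
  rewrite rowK grad_edge ?(fintype.subsetP fT) //.
  move: iTf; rewrite inE => /andP[if_ _].
  have /negbTE -> : i != nth v0 s j by apply: contraNneq if_ => ->.
  have /negbTE -> : i != v0 by apply: contraNneq if_ => ->.
  by rewrite subrr mulr0.
rewrite mulr0 addr0 grad_sum (bigD1 i) //= iTf.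
move: (iTf); rewrite inE => /andP[if_ iT].
have iv0 : i != v0 by apply: contraNneq if_ => ->.
rewrite grad_edge // eqxx (negbTE iv0) subr0 mulr1 big1 ?addr0 // => j ji.
case: ifP => jTf; last by rewrite mul0r.
move: jTf; rewrite inE => /andP[_ jT].
by rewrite grad_edge // eq_sym (negbTE ji) (negbTE iv0) subrr mulr0.
Qed.

End Cell.

(** * Bernstein form on a cell *)

Section CellVertices.
Variables (n : nat) (V : finType) (T : {set V}) (tau : 'I_n.+1 -> V).
Hypothesis tau_inj : injective tau.
Hypothesis tauT : forall v, (v \in T) = (v \in codom tau).

Lemma big_cell (A : Type) (idx : A) (op : Monoid.com_law idx) (f : {set V})
    (F : V -> A) : f \subset T ->
  \big[op/idx]_(v in f) F v = \big[op/idx]_(i | tau i \in f) F (tau i).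
Proof.
move=> fT; rewrite big_mkcond [RHS]big_mkcond /=.
rewrite (bigID (mem T)) /= [X in op _ X]big1 ?Monoid.mulm1; last first.
  move=> v vT; case: ifP => // vf.
  by rewrite (fintype.subsetP fT) in vT.
rewrite -(big_image _ _ tau predT (fun v => if v \in f then F v else idx)) /=.
rewrite -big_enum /=; apply: perm_big; apply: uniq_perm.
- exact: enum_uniq.
- by rewrite map_inj_uniq ?enum_uniq.
- by move=> v; rewrite mem_enum tauT.
Qed.

Definition cell_index (v : V) : 'I_n.+1 := odflt ord0 [pick i | tau i == v].

Lemma tauK : cancel tau cell_index.
Proof.
move=> i; rewrite /cell_index; case: pickP => [j /eqP/tau_inj //|/(_ i)].
by rewrite eqxx.
Qed.

Lemma cell_indexK v : v \in T -> tau (cell_index v) = v.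
Proof. by rewrite tauT => /codomP[i ->]; rewrite tauK. Qed.

End CellVertices.

Lemma cell_vertices (n : nat) (V : finType) (T : {set V}) : #|T| = n.+1 ->
  exists2 tau : 'I_n.+1 -> V,
    injective tau & forall v, (v \in T) = (v \in codom tau).
Proof.
move=> Tn; exists (fun i => enum_val (cast_ord (esym Tn) i)).
  by move=> i j /enum_val_inj/cast_ord_inj.
move=> v; apply/idP/codomP => [vT|[i ->]]; last exact: enum_valP.
exists (cast_ord Tn (enum_rank_in vT v)).
by rewrite cast_ordK enum_rankK_in.
Qed.

Section Bernstein.
Variables (R : realType) (n : nat) (V : finType) (X : V -> 'rV[R]_n).
Variables (T : {set V}) (tau : 'I_n.+1 -> V).
Hypotheses (Tn : #|T| = n.+1) (Tind : affinely_independent X T).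
Hypothesis tau_inj : injective tau.
Hypothesis tauT : forall v, (v \in T) = (v \in codom tau).

(* Bernstein polynomials without the multinomial factors: the homogeneous p is
   evaluated at the barycentric coordinates. *)
Definition bernstein (p : mpoly n.+1 R) : mpoly n R :=
  msubst (fun i => bary_poly X T (tau i)) p.

Lemma bernstein_surj (k : nat) (u : mpoly n R) : (msize u <= k.+1)%N ->
  exists2 p, p \is ishomog1 k mdeg & bernstein p = u.
Proof.
move=> uk.
apply: (@homogenize _ _ _ (fun i => bary_poly X T (tau i)) (X \o tau)) => //.
- rewrite -[RHS](sum_bary_poly Tn Tind) (big_cell tau_inj tauT) //.
  by apply: eq_bigl => i; rewrite tauT codom_f.
- move=> j; rewrite -[RHS](sum_bary_polyX Tn Tind) (big_cell tau_inj tauT) //.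
  by apply: eq_bigl => i; rewrite tauT codom_f.
Qed.

Section Face.
Variable f : {set V}.
Hypotheses (fT : f \subset T) (fN0 : f != finset.set0).

Definition mdeg_off (m : multinom n.+1) : nat := (\sum_(i | tau i \notin f) m i)%N.

Definition face_monomial (m : multinom n.+1) : mpoly n R :=
  \prod_(i | tau i \in f) bary_poly X T (tau i) ^+ m i.

Section Frame.
Variables (q : nat) (W : 'M[R]_(q, n)).

(** The linear part of a barycentric coordinate along the frame. At a point of f it is the whole
    expansion when the vertex is off f. *)
Definition slope (i : 'I_n.+1) : mpoly q R :=
  \sum_j grad X T (row j W) (tau i) *: mvar j.

Definition off_monomial (m : multinom n.+1) : mpoly q R :=
  \prod_(i | tau i \notin f) slope i ^+ m i.

Lemma slope_homog i : slope i \is ishomog1 1 mdeg.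
Proof.
by apply: rpred_sum => j _; apply: rpredZ; rewrite dhomogX /= mdeg1.
Qed.

Lemma off_monomial_homog m : off_monomial m \is ishomog1 (mdeg_off m) mdeg.
Proof. exact: homog_prod_exp slope_homog. Qed.

Lemma meval_slope i (z : 'rV[R]_q) :
  meval (z 0) (slope i) = grad X T (z *m W) (tau i).
Proof.
rewrite mulmx_sum_row (grad_sum Tn Tind) raddf_sum; apply: eq_bigr => j _ /=.
by rewrite mevalZ mevalXU mulrC.
Qed.

(** In each term the factors off f form a homogeneous polynomial of degree at least s, so the
    factors on f enter only by their value at x, through [mcoeffM_homog]. *)
Lemma mcoeff_bernstein_face (s : nat) (p : mpoly n.+1 R) x (b : multinom q) :
  (forall m, m \in msupp p -> (s <= mdeg_off m)%N) -> (mdeg b <= s)%N ->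
  (forall v, v \notin f -> bary X T x v = 0) ->
  mcoeff b (msubst (frame_point x W) (bernstein p)) =
  \sum_(m <- msupp p)
    mcoeff m p * (peval (face_monomial m) x * mcoeff b (off_monomial m)).
Proof.
move=> ps bs x0; rewrite /bernstein msubst_comp msubstE raddf_sum /=.
rewrite big_seq [RHS]big_seq. apply: eq_bigr => m mp; rewrite mcoeffZ.
congr (_ * _); rewrite (bigID (fun i => tau i \in f)) /=.
have -> : \prod_(i | tau i \notin f)
    msubst (frame_point x W) (bary_poly X T (tau i)) ^+ m i = off_monomial m.
  apply: eq_bigr => i iF.
  by rewrite (bary_poly_frame Tn Tind) x0 // mpolyC0 add0r.
rewrite (mcoeffM_homog _ (off_monomial_homog m)); last first.
  exact: leq_trans (ps _ mp).
congr (_ * _); rewrite /peval /face_monomial !rmorph_prod /=.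
apply: eq_bigr => i _; rewrite !rmorphXn /=; congr (_ ^+ _).
by rewrite mcoeff0_frame_point.
Qed.

(** Converts vanishing Bernstein coefficients near f into vanishing derivatives on f; the frame is
    arbitrary. *)
Lemma bernstein_der_face_eq0 (s : nat) (p : mpoly n.+1 R) x (b : multinom q) :
  (forall m, m \in msupp p -> (s < mdeg_off m)%N) -> (mdeg b <= s)%N ->
  (forall v, v \notin f -> bary X T x v = 0) ->
  peval (frame_der W b (bernstein p)) x = 0.
Proof.
move=> ps bs x0; apply/peval_frame_der_eq0.
rewrite (mcoeff_bernstein_face _ bs x0) => [|m /ps/ltnW //].
rewrite big_seq big1 // => m mp.
rewrite (dhomog_nemf_coeff (off_monomial_homog m)) ?mulr0 //=.
by rewrite ltn_eqF // (leq_ltn_trans bs) // ps.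
Qed.

(* Testing a normal derivative of lowest order against its own Bernstein terms
   on f gives the integral of its square. *)
Lemma bernstein_step (k s : nat) (p : mpoly n.+1 R) :
  p \is ishomog1 k mdeg ->
  (forall m, m \in msupp p -> (s <= mdeg_off m)%N) ->
  (forall mu : V -> R, exists z : 'rV[R]_q,
     forall v, v \in T :\: f -> grad X T (z *m W) v = mu v) ->
  (forall m (b : multinom q), m \in msupp p -> mdeg_off m = s -> mdeg b = s ->
     simplex_int X f
       (peval (frame_der W b (bernstein p) * face_monomial m)) = 0) ->
  forall m, m \in msupp p -> (s < mdeg_off m)%N.
Proof.
move=> pk ps Wsurj dof.
have off0 m (b : multinom q) : m \in msupp p -> mdeg b = s ->
    mdeg_off m != s -> mcoeff b (off_monomial m) = 0.
  move=> _ bs ms; rewrite (dhomog_nemf_coeff (off_monomial_homog m)) //=.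
  by rewrite bs eq_sym.
have ident w x : bary_coords X f x w -> forall v, v \notin f -> bary X T x v = 0.
  by move=> xw v vf; rewrite (bary_face Tn Tind fT xw); case: xw => ->.
have der0 (b : multinom q) x w : mdeg b = s -> bary_coords X f x w ->
    (forall v, v \in f -> 0 < w v) -> peval (frame_der W b (bernstein p)) x = 0.
  move=> bs xw w0; set D := frame_der W b (bernstein p).
  apply: (simplex_int_sqr_eq0 fN0 (affinely_independent_sub fT Tind) _ xw w0).
  (* The coefficients that express the derivative, restricted to f, through the face monomials. *)
  pose c m := mcoeff m p * mcoeff b (off_monomial m) *+ \prod_(i < q) (b i)`!.
  transitivity (simplex_int X f
      (peval (\sum_(m <- msupp p) c m *: (D * face_monomial m)))).
    apply: eq_simplex_int => y v yv.
    have DE : peval D y = \sum_(m <- msupp p) c m * peval (face_monomial m) y.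
      rewrite peval_frame_der.
      rewrite (mcoeff_bernstein_face ps _ (ident _ _ yv)) ?bs //.
      rewrite -sumrMnl; apply: eq_bigr => m _.
      by rewrite /c mulrnAl [_ * peval _ _]mulrAC mulrA.
    rewrite /peval mevalM raddf_sum /= -/(peval D y) {2}DE mulr_sumr.
    by apply: eq_bigr => m _; rewrite mevalZ mevalM mulrCA.
  rewrite simplex_int_sum big_seq big1 // => m mp.
  have [ms|ms] := eqVneq (mdeg_off m) s; first by rewrite dof ?mulr0.
  by rewrite /c (off0 _ _ mp bs ms) mulr0 mul0rn mul0r.
pose P := \sum_(m <- msupp p | mdeg_off m == s) mcoeff m p *: mpolyX R m.
have P0 : P = 0.
  apply: mpoly_eq0_pos => t t0.
  (* After division of t by [sg], the entries on f are barycentric coordinates of an interior point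
     x of f, and the entries off f serve as gradients to be prescribed through [Wsurj]. *)
  pose sg := \sum_(i | tau i \in f) t i.
  have sg0 : 0 < sg.
    have [v vf] := finset.set0Pn _ fN0.
    have vE := cell_indexK tau_inj tauT (fintype.subsetP fT _ vf).
    rewrite /sg (bigD1 (cell_index tau v)) /= ?vE //.
    by rewrite ltr_pwDl // sumr_ge0 // => i _; apply: ltW.
  pose t' v := t (cell_index tau v) / sg.
  have t'E i : t' (tau i) = t i / sg by rewrite /t' tauK.
  pose w v := if v \in f then t' v else 0.
  pose x := \sum_(v in f) w v *: X v.
  have xw : bary_coords X f x w.
    split=> [v /negbTE vf||//]; first by rewrite /w vf.
    rewrite (big_cell tau_inj tauT) //.
    rewrite (eq_bigr (fun i => t i / sg)) => [|i fi]; last by rewrite /w fi t'E.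
    by rewrite -mulr_suml divff // lt0r_neq0.
  have w0 v : v \in f -> 0 < w v by move=> vf; rewrite /w vf divr_gt0.
  have bx := bary_face Tn Tind fT xw.
  have [z zE] := Wsurj t'.
  (* The order-s part of the expansion at x. Its value at z is that of [P] at t / sg, term by
     term. *)
  pose H := \sum_(m <- msupp p | mdeg_off m == s)
    (mcoeff m p * peval (face_monomial m) x) *: off_monomial m.
  have Hh : H \is ishomog1 s mdeg.
    apply: rpred_sum => m /eqP ms; apply: rpredZ.
    by rewrite -ms; apply: off_monomial_homog.
  have H0 : H = 0.
    apply/mpolyP => b; rewrite mcoeff0.
    have [bs|bs] := eqVneq (mdeg b) s; last exact: dhomog_nemf_coeff Hh bs.
    have := der0 b x w bs xw w0; rewrite peval_frame_der_eq0.
    rewrite (mcoeff_bernstein_face ps _ (ident _ _ xw)) ?bs // => <-.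
    rewrite raddf_sum /= big_mkcond big_seq [RHS]big_seq.
    apply: eq_bigr => m mp; rewrite mcoeffZ mulrA.
    by case: ifPn => // ms; rewrite (off0 _ _ mp bs ms) mulr0.
  have Ph : P \is ishomog1 k mdeg.
    rewrite /P big_seq_cond; apply: rpred_sum => m /andP[mp _]; apply: rpredZ.
    by rewrite dhomogX /= (dhomogP _ _ _ pk _ mp).
  have -> : meval t P = meval (fun i => sg * (t i / sg)) P.
    by apply: meval_eq => i; rewrite mulrC divfK // lt0r_neq0.
  rewrite (meval_homog _ _ Ph); apply/eqP; rewrite mulf_eq0; apply/orP; right.
  apply/eqP; rewrite -[RHS](meval0 (z 0)) -H0 /P /H !raddf_sum.
  apply: eq_bigr => m _ /=; rewrite !mevalZ mevalX -mulrA; congr (_ * _).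
  rewrite (bigID (fun i => tau i \in f)) /=; congr (_ * _).
    rewrite /peval rmorph_prod; apply: eq_bigr => i fi /=.
    by rewrite rmorphXn /= -/(peval _ x) (peval_bary_poly Tn Tind) bx /w fi t'E.
  rewrite rmorph_prod; apply: eq_bigr => i fi /=.
  rewrite rmorphXn /= meval_slope zE ?t'E // inE fi /= tauT.
  exact: codom_f.
move=> m mp; rewrite ltn_neqAle ps // andbT; apply/negP => /eqP ms.
have := congr1 (mcoeff m) P0; rewrite mcoeff0 /P raddf_sum /=.
rewrite big_mkcond (bigD1_seq m) ?msupp_uniq //= -ms eqxx mcoeffZ mcoeffX eqxx.
rewrite mulr1 big1 ?addr0 => [/eqP|m' /negbTE m'm].
  by rewrite mcoeff_eq0 mp.
by case: ifP => // _; rewrite mcoeffZ mcoeffX m'm mulr0.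
Qed.

End Frame.
End Face.
End Bernstein.

(** * Decomposition of the simplicial lattice *)

Section Lattice.
Variables (V : finType) (k n : nat) (r : nat -> nat).
Implicit Types (T f e : {set V}) (alpha : {ffun V -> nat}).

Hypothesis rn : r n = 0%N.
Hypothesis r_double : forall l, (l.+2 <= n)%N -> (2 * r l.+1 <= r l)%N.

(** The doubling hypothesis stops at the pair (n-2, n-1); the last step to n holds because [r n] is
    0. *)
Lemma r_doubling i j : (i < j)%N -> (j <= n)%N -> (2 * r j <= r i)%N.
Proof.
elim: j => [//|j IH]; rewrite ltnS leq_eqVlt => /predU1P[->|ij] jn.
  by move: jn; rewrite leq_eqVlt => /predU1P[->|/r_double //]; rewrite rn.
have := IH ij (ltnW jn).
have : (2 * r j.+1 <= r j)%N.
  by move: jn; rewrite leq_eqVlt => /predU1P[->|/r_double //]; rewrite rn.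
lia.
Qed.

Lemma r_mono i j : (i <= j)%N -> (j <= n)%N -> (r j <= r i)%N.
Proof.
by rewrite leq_eqVlt => /predU1P[-> //|ij jn]; have := r_doubling ij jn; lia.
Qed.

Lemma DeltaP l f T : reflect (f \subset T /\ #|f| = l.+1) (f \in Delta l T).
Proof. by rewrite inE; apply: (iffP andP) => -[fT /eqP]. Qed.

Lemma Delta_trans i l e f T : e \in Delta i f -> f \in Delta l T ->
  e \in Delta i T.
Proof.
move=> /DeltaP[ef ei] /DeltaP[fT _]; apply/DeltaP; split=> //.
exact: fintype.subset_trans ef fT.
Qed.

Lemma Delta_leq l f T : #|T| = n.+1 -> f \in Delta l T -> (l <= n)%N.
Proof. by move=> Tn /DeltaP[/subset_leq_card]; rewrite Tn => /[swap] ->. Qed.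

Lemma mlattice_deg T alpha : mlattice k T alpha -> mdeg_on T alpha = k.
Proof. by case/andP => _ /eqP. Qed.

Lemma mdeg_onID T f alpha : f \subset T ->
  (mdeg_on f alpha + Defs.mdist T f alpha)%N = mdeg_on T alpha.
Proof.
by move=> fT; rewrite /Defs.mdist /mdeg_on [RHS](big_setID f) /= (finset.setIidPr fT).
Qed.

Lemma vdistE T f alpha : f \subset T -> mlattice k T alpha ->
  Defs.mdist T f alpha = (k - mdeg_on f alpha)%N.
Proof. by move=> fT /mlattice_deg <-; rewrite -(mdeg_onID _ fT) addKn. Qed.

(** Written with k - |alpha_e| for e inside f, the conditions on distances see alpha only on f; this
    makes the index set of f independent of the cell. *)
Lemma SfaceE T l f alpha : f \subset T ->
  Sface k r T l f alpha =
  [&& mlattice k T alpha, (k - mdeg_on f alpha <= r l)%N &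
    ~~ [exists i : 'I_l, [exists e in Delta i f, (k - mdeg_on e alpha <= r i)%N]]].
Proof.
move=> fT; rewrite /Sface /mball_lower /mball.
have [aT|//] := boolP (mlattice k T alpha); rewrite /= vdistE //.
congr (_ && ~~ _); apply: eq_existsb => i; apply: eq_existsb => e.
have [/DeltaP[ef _]|//] := boolP (e \in Delta i f).
by rewrite vdistE // (fintype.subset_trans ef fT).
Qed.

Lemma eq_mdeg_on f alpha alpha' : (forall v, v \in f -> alpha v = alpha' v) ->
  mdeg_on f alpha = mdeg_on f alpha'.
Proof. exact: eq_bigr. Qed.

Lemma Sface_transfer T T' l f alpha alpha' :
  f \subset T -> f \subset T' -> mlattice k T alpha -> mlattice k T' alpha' ->
  (forall v, v \in f -> alpha v = alpha' v) ->
  Sface k r T l f alpha -> Sface k r T' l f alpha'.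
Proof.
move=> fT fT' aT aT' aa'; rewrite !SfaceE // aT aT' /= (eq_mdeg_on aa').
move=> /andP[-> /=]; apply: contra => /existsP[i /existsP[e /andP[ei ee]]].
apply/existsP; exists i; apply/existsP; exists e; rewrite ei /=.
case/DeltaP: ei => /fintype.subsetP ef _.
by rewrite (@eq_mdeg_on e alpha alpha') // => v /ef/aa'.
Qed.

(** Take a face of least dimension whose ball contains alpha; T itself is a candidate, at distance
    0. *)
Lemma Sface_exists T alpha : #|T| = n.+1 -> mlattice k T alpha ->
  exists l f, f \in Delta l T /\ Sface k r T l f alpha.
Proof.
move=> Tn aT.
pose P l := [exists f in Delta l T, mball k T f (r l) alpha].
have exP : exists l, P l.
  exists n; apply/existsP; exists T; apply/andP; split.
    by apply/DeltaP; split.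
  by rewrite /mball aT /Defs.mdist finset.setDv /mdeg_on big_set0.
case: (ex_minnP exP) => l /existsP[f /andP[fl fb]] lmin.
exists l, f; split=> //; rewrite /Sface fb /=.
apply/negP => /existsP[i /existsP[e /andP[ei eb]]].
have : P i.
  by apply/existsP; exists e; rewrite (Delta_trans ei fl).
by move/lmin; rewrite leqNgt ltn_ord.
Qed.

Lemma vdistI T f f' alpha :
  (Defs.mdist T (f :&: f') alpha <= Defs.mdist T f alpha + Defs.mdist T f' alpha)%N.
Proof.
rewrite /Defs.mdist /mdeg_on (finset.setDIr T) (big_setID (T :\: f)) /=.
apply: leq_add.
  rewrite [X in (_ <= X)%N](big_setID (T :\: f :|: T :\: f')) /=.
  by rewrite finset.setIC leq_addr.
rewrite [X in (_ <= X)%N](big_setID (T :\: f)) /=.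
rewrite finset.setDUl finset.setDv finset.set0U leq_addl //.
Qed.

Hypothesis rk : (2 * r 0 + 1 <= k)%N.

(** If f' lies strictly inside f, alpha is in a ball removed from f. Otherwise e = f :&: f' has
    dimension i < l' <= l, and the distance to e is at most r l + r l' <= 2 r l' <= r i, so alpha is
    in a ball removed from f'. An empty e would give k <= 2 r 0. *)
Lemma Sface_uniq T l l' f f' alpha : #|T| = n.+1 ->
  f \in Delta l T -> f' \in Delta l' T ->
  Sface k r T l f alpha -> Sface k r T l' f' alpha -> f = f'.
Proof.
move=> Tn.
wlog ll' : l l' f f' / (l' <= l)%N.
  move=> wl fl fl' Sf Sf'; have [/wl|/ltnW/wl] := leqP l' l; first exact.
  by move=> /(_ f' f) /(_ fl' fl Sf' Sf) ->.
move=> fl fl' /andP[fb fN] /andP[fb' fN'].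
have [fT fc] := DeltaP _ _ _ fl; have [fT' fc'] := DeltaP _ _ _ fl'.
have ln := Delta_leq Tn fl; have ln' := Delta_leq Tn fl'.
have aT : mlattice k T alpha by case/andP: fb.
have db : (Defs.mdist T f alpha <= r l)%N by case/andP: fb.
have db' : (Defs.mdist T f' alpha <= r l')%N by case/andP: fb'.
have [f'f|f'f] := boolP (f' \subset f).
  apply/eqP; rewrite eq_sym eqEcard f'f fc fc' ltnS leqNgt; apply: contra fN => l'l.
  apply/existsP; exists (Ordinal l'l); apply/existsP; exists f'.
  by rewrite fb' andbT; apply/DeltaP.
pose e := f :&: f'.
have eT : e \subset T by apply: fintype.subset_trans (finset.subsetIl _ _) fT.
have de : (Defs.mdist T e alpha <= r l + r l')%N.
  by apply: leq_trans (vdistI _ _ _ _) _; apply: leq_add.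
have rr := r_mono ll' ln.
have ef' : (#|e| < l'.+1)%N.
  rewrite -fc'; apply: fintype.proper_card; rewrite fintype.properE finset.subsetIr /=.
  by apply: contra f'f => /fintype.subset_trans; apply; apply: finset.subsetIl.
have [i ei] : exists i, #|e| = i.+1.
  case ec: #|e| => [|i]; last by exists i.
  move/eqP: ec; rewrite cards_eq0 => /eqP e0.
  move: de; rewrite e0 vdistE ?finset.sub0set // /mdeg_on big_set0.
  rewrite subn0 => kr; have r0 := r_mono (leq0n l') ln'.
  by clear - kr r0 rr rk; lia.
rewrite ei ltnS in ef'.
have il : (i < l)%N by apply: leq_trans ll'.
case/negP: fN'; apply/existsP; exists (Ordinal ef'); apply/existsP; exists e.
rewrite /mball aT /=; apply/andP; split.
  by apply/DeltaP; rewrite finset.subsetIr.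
apply: leq_trans de _; have rd := r_doubling ef' ln'.
by clear - rd rr; lia.
Qed.

End Lattice.

Lemma big_set_enum (A : Type) (idx : A) (op : Monoid.com_law idx) (V : finType)
    (f : {set V}) (v0 : V) (q : nat) (F : V -> A) : #|f| = q ->
  \big[op/idx]_(v in f) F v = \big[op/idx]_(j < q) F (nth v0 (enum f) j).
Proof.
by move=> fq; rewrite -big_enum (big_nth v0) -cardE fq big_mkord.
Qed.

Section Spread.
Variables (V : finType) (T f : {set V}) (v0 : V) (q : nat).
Hypothesis fT : f \subset T.
Hypothesis Tfq : #|T :\: f| = q.

(** The normal derivative index beta attached to alpha: its entries off f, in the order of [enum].
    With [spread] this renames each alpha as a pair (alpha_f, beta). *)
Definition off_index (alpha : {ffun V -> nat}) : multinom q :=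
  Multinom [tuple alpha (nth v0 (enum (T :\: f)) j) | j < q].

(* alpha on f, and the multi-index b on the vertices of T off f. *)
Definition spread (alpha : {ffun V -> nat}) (b : multinom q) : {ffun V -> nat} :=
  [ffun v => if v \in f then alpha v else
    oapp b 0%N (insub (index v (enum (T :\: f))))].

Lemma spread_in alpha b v : v \in f -> spread alpha b v = alpha v.
Proof. by rewrite ffunE => ->. Qed.

Lemma spread_nth alpha b (j : 'I_q) :
  spread alpha b (nth v0 (enum (T :\: f)) j) = b j.
Proof.
have jq : (j < size (enum (T :\: f)))%N by rewrite -cardE Tfq.
rewrite ffunE; have := mem_nth v0 jq; rewrite mem_enum inE => /andP[/negbTE -> _].
by rewrite index_uniq ?enum_uniq // valK.
Qed.

Lemma off_indexK alpha b : off_index (spread alpha b) = b.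
Proof. by apply/mnmP => j; rewrite mnmE spread_nth. Qed.

Lemma vdist_off_index alpha : mdeg (off_index alpha) = Defs.mdist T f alpha.
Proof.
rewrite mdegE /Defs.mdist /mdeg_on (big_set_enum _ v0 _ Tfq).
by apply: eq_bigr => j _; rewrite mnmE.
Qed.

Lemma vdist_spread alpha b : Defs.mdist T f (spread alpha b) = mdeg b.
Proof. by rewrite -vdist_off_index off_indexK. Qed.

Lemma mlattice_spread k alpha b :
  (mdeg_on f alpha + mdeg b = k)%N -> mlattice k T (spread alpha b).
Proof.
move=> sk; apply/andP; split.
  apply/forallP => v; apply/implyP => vT; rewrite ffunE ifF; last first.
    by apply: contraNF vT; apply: (fintype.subsetP fT).
  rewrite insubF // -Tfq cardE index_mem mem_enum inE.
  by rewrite (negbTE vT) andbF.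
rewrite -[X in X == _]/(mdeg_on T _) -(mdeg_onID _ fT) vdist_spread -sk.
by rewrite (@eq_mdeg_on _ f _ alpha) // => v /spread_in.
Qed.

End Spread.

(** All of the missing degree is put on v. This serves to reinterpret an index on f within another
    cell. *)
Lemma mlattice_extend (V : finType) (k : nat) (T f : {set V})
    (alpha : {ffun V -> nat}) (v : V) :
  f \subset T -> v \in T :\: f -> (mdeg_on f alpha <= k)%N ->
  exists2 alpha' : {ffun V -> nat}, mlattice k T alpha' &
    forall i, i \in f -> alpha' i = alpha i.
Proof.
move=> fT vTf ak; move: (vTf); rewrite inE => /andP[vf vT].
pose alpha' : {ffun V -> nat} := [ffun i => if i \in f then alpha i
   else if i == v then (k - mdeg_on f alpha)%N else 0%N].
have aE i : i \in f -> alpha' i = alpha i by rewrite ffunE => ->.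
exists alpha' => //; apply/andP; split.
  apply/forallP => i; apply/implyP => iT; rewrite ffunE ifF; last first.
    by apply: contraNF iT; apply: (fintype.subsetP fT).
  by rewrite ifF //; apply: contraNF iT => /eqP ->.
rewrite -[X in X == _]/(mdeg_on T _) -(mdeg_onID _ fT) (eq_mdeg_on aE).
rewrite /Defs.mdist [mdeg_on (T :\: f) _](bigD1 v) //= big1 => [|i].
  by rewrite ffunE (negbTE vf) eqxx addn0 subnKC.
rewrite inE => /andP[/andP[/negbTE if_ _] /negbTE iv].
by rewrite ffunE if_ iv.
Qed.

(** * Degrees of freedom of a cell *)

Section DegreeBound.
Variable R : realType.

Lemma msizeM_leS (n : nat) (p q : mpoly n R) (a b : nat) :
  (msize p <= a.+1)%N -> (msize q <= b.+1)%N -> (msize (p * q) <= (a + b).+1)%N.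
Proof.
move=> pa qb; have [->|p0] := eqVneq p 0; first by rewrite mul0r msize0.
have [->|q0] := eqVneq q 0; first by rewrite mulr0 msize0.
rewrite msizeM // -subn1 leq_subLR; have := leq_add pa qb.
by rewrite addSn addnS add1n.
Qed.

Lemma msize_bernstein (n : nat) (V : finType) (X : V -> 'rV[R]_n) (T : {set V})
    (tau : 'I_n.+1 -> V) (k : nat) (p : mpoly n.+1 R) :
  p \is ishomog1 k mdeg -> (msize (bernstein X T tau p) <= k.+1)%N.
Proof.
move=> pk; rewrite /bernstein msubstE.
have size_sum (I : Type) (s : seq I) (P : pred I) (F : I -> mpoly n R) d :
    (forall i, P i -> (msize (F i) <= d)%N) ->
    (msize (\sum_(i <- s | P i) F i) <= d)%N.
  move=> Fd; elim/big_ind: _ => [|x y xd yd|//]; first by rewrite msize0.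
  by apply: leq_trans (msizeD_le x y) _; rewrite geq_max xd.
rewrite big_seq; apply: (size_sum) => m mp.
apply: leq_trans (msizeZ_le _ _) _; rewrite -(dhomogP _ _ _ pk m mp) /= mdegE.
apply: (big_ind2 (fun (q : mpoly n R) d => (msize q <= d.+1)%N)).
- by rewrite msize1.
- by move=> q1 d1 q2 d2 h1 h2; apply: msizeM_leS.
- move=> i _; elim: (m i) => [|e IH]; first by rewrite expr0 msize1.
  rewrite exprS; apply: (@msizeM_leS _ _ _ 1 e _ IH).
  apply: leq_trans (msizeD_le _ _) _; rewrite geq_max; apply/andP; split.
    by rewrite msizeC; case: (_ != 0).
  apply: size_sum => j _; apply: leq_trans (msizeZ_le _ _) _.
  by rewrite msizeX mdeg1.
Qed.

End DegreeBound.

(** A multi-index of length n - 0 cannot be used directly at length n, the two being equal but not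
    convertible. Reading the entries with default 0 avoids transport along the equality. *)
Definition mcast (q n : nat) (b : multinom q) : multinom n :=
  Multinom [tuple oapp b 0%N (insub (val i)) | i < n].

Lemma mcastE (n : nat) (b : multinom n) : mcast n b = b.
Proof. by apply/mnmP => i; rewrite mnmE valK. Qed.

Lemma mdeg_mcast (q n : nat) (b : multinom q) : q = n -> mdeg (mcast n b) = mdeg b.
Proof. by move=> qn; subst q; rewrite mcastE. Qed.

Lemma mcast_surj (q n : nat) (a : multinom n) : q = n ->
  exists b : multinom q, mcast n b = a.
Proof. by move=> qn; subst q; exists a; rewrite mcastE. Qed.

Lemma frame_der_pid (R : realType) (q n : nat) (b : multinom q)
    (p : mpoly n R) : q = n ->
  frame_der (pid_mx n : 'M[R]_(q, n)) b p = mderivm (mcast n b) p.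
Proof. by move=> qn; subst q; rewrite mcastE pid_mx_1 frame_der1. Qed.

Lemma pid_mx_surj (R : realType) (q n : nat) (y : 'rV[R]_n) : q = n ->
  exists z : 'rV[R]_q, z *m pid_mx n = y.
Proof. by move=> qn; subst q; exists y; rewrite pid_mx_1 mulmx1. Qed.

Section Dofs.
Variables (R : realType) (n : nat) (V : finType) (X : V -> 'rV[R]_n).
Variables (k : nat) (r : nat -> nat).
Variable nf : forall l : nat, {set V} -> 'M[R]_(n - l, n).

(** With n - 0 rows, [pid_mx n] is the identity matrix, typed without a cast. *)
Definition dof_frame (l : nat) (f : {set V}) : 'M[R]_(n - l, n) :=
  if l is 0%N then pid_mx n else nf l f.

(* The functionals (F0), (F1) and (F2) in a common form: at a vertex the integral
   is point evaluation and the derivatives are the partial ones; on a cell there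
   is no normal direction. *)
Definition dof (T : {set V}) (l : nat) (f : {set V}) (alpha : {ffun V -> nat})
    (b : multinom (n - l)) (u : mpoly n R) : R :=
  simplex_int X f (fun x => peval (frame_der (dof_frame l f) b u) x *
                            bary_monomial X T f alpha x).

Definition dof_index (T : {set V}) (l : nat) (f : {set V}) (s : nat)
    (alpha : {ffun V -> nat}) (b : multinom (n - l)) : Prop :=
  [/\ f \in Delta l T, (s <= r l)%N, Sface k r T l f alpha,
      mdeg_on f alpha = (k - s)%N & mdeg b = s].

Definition has_dofs (T : {set V})
    (D : forall l, {set V} -> {ffun V -> nat} -> multinom (n - l) -> R)
    (u : mpoly n R) : Prop :=
  forall l f s alpha (b : multinom (n - l)), dof_index T f s alpha b ->
    dof T f alpha b u = D l f (Defs.mrestr f alpha) b.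

Section OneCell.
Variable T : {set V}.
Hypotheses (Tn : #|T| = n.+1) (Tind : affinely_independent X T).

Definition lam_monomial (f : {set V}) (alpha : {ffun V -> nat}) : mpoly n R :=
  \prod_(v in f) bary_poly X T v ^+ alpha v.

Lemma dofE l f alpha (b : multinom (n - l)) u : dof T f alpha b u =
  simplex_int X f (peval (frame_der (dof_frame l f) b u * lam_monomial f alpha)).
Proof.
rewrite /dof; congr simplex_int; apply/funext => x.
rewrite /peval mevalM /bary_monomial /lam_monomial rmorph_prod; congr (_ * _).
apply: eq_bigr => v _; rewrite /= rmorphXn /= -(peval_bary_poly Tn Tind).
by [].
Qed.

Lemma dof_sum l f alpha (b : multinom (n - l)) (I : Type) (s : seq I)
    (c : I -> R) (p : I -> mpoly n R) :
  dof T f alpha b (\sum_(i <- s) c i *: p i) =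
  \sum_(i <- s) c i * dof T f alpha b (p i).
Proof.
rewrite dofE frame_der_sum mulr_suml.
under eq_bigr do rewrite -scalerAl.
rewrite simplex_int_sum; apply: eq_bigr => i _.
by rewrite dofE.
Qed.

Lemma dofB l f alpha (b : multinom (n - l)) p q :
  dof T f alpha b (p - q) = dof T f alpha b p - dof T f alpha b q.
Proof.
(* The difference is a sum over booleans with coefficients 1 and -1. *)
have := dof_sum f alpha b (index_enum bool)
  (fun c : bool => if c then 1 else -1) (fun c : bool => if c then p else q).
rewrite !big_bool /= scale1r scaleN1r mul1r mulN1r.
exact.
Qed.

Lemma eq_dof l (f : {set V}) (alpha alpha' : {ffun V -> nat})
    (b : multinom (n - l)) u :
  (forall v, v \in f -> alpha v = alpha' v) ->
  dof T f alpha b u = dof T f alpha' b u.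
Proof.
move=> aa; rewrite !dofE; congr (simplex_int _ _ (peval (_ * _))).
by apply: eq_bigr => v vf; rewrite aa.
Qed.

Hypothesis nfT : forall l f, (1 <= l <= n.-1)%N -> f \in Delta l T ->
  normal_frame X f (nf l f).

(** For 0 < l < n this is the property of normal frames; at a vertex every direction is normal, and
    for l = n there is no vertex off f. *)
Lemma dof_frame_surj l f : f \in Delta l T -> forall mu : V -> R,
  exists z : 'rV[R]_(n - l),
    forall v, v \in T :\: f -> grad X T (z *m dof_frame l f) v = mu v.
Proof.
move=> fl mu; have [fT fc] := DeltaP _ _ _ fl; have ln := Delta_leq Tn fl.
have f0 : f != finset.set0 by rewrite -card_gt0 fc.
case: l fl fc ln => [|l] fl fc ln /=; last first.
  have [ln'|ln'] := leqP l.+1 n.-1.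
    by apply: (normal_frame_surj Tn Tind fT f0 (nfT _ fl)).
  exists 0 => v; suff -> : f = T by rewrite finset.setDv finset.in_set0.
  by apply/eqP; rewrite eqEcard fT Tn fc; move: ln' ln; case: n => //=; lia.
have [v0 fE] : exists v0, f = [set v0]%SET by apply/cards1P/eqP.
have n1 : normal_frame X f (1%:M : 'M[R]_n).
  move=> w; rewrite submx1 fE; split=> // _ i j /finset.set1P -> /finset.set1P ->.
  by rewrite subrr trmx0 mulmx0.
have [y yE] := normal_frame_surj Tn Tind fT f0 n1 mu.
have [z zE] := pid_mx_surj y (subn0 n).
by exists z => v vTf; rewrite zE -yE // mulmx1.
Qed.

Variable tau : 'I_n.+1 -> V.
Hypothesis tau_inj : injective tau.
Hypothesis tauT : forall v, (v \in T) = (v \in codom tau).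

Definition mnm_alpha (m : multinom n.+1) : {ffun V -> nat} :=
  [ffun v => if v \in T then m (cell_index tau v) else 0%N].

Definition alpha_mnm (alpha : {ffun V -> nat}) : multinom n.+1 :=
  Multinom [tuple alpha (tau i) | i < n.+1].

Lemma tau_in i : tau i \in T.
Proof. by rewrite tauT codom_f. Qed.

Lemma mnm_alphaE m i : mnm_alpha m (tau i) = m i.
Proof. by rewrite ffunE tau_in tauK. Qed.

Lemma alpha_mnmK alpha : mlattice k T alpha -> mnm_alpha (alpha_mnm alpha) = alpha.
Proof.
case/andP=> /forallP a0 _; apply/ffunP => v; rewrite ffunE.
have [vT|vT] := boolP (v \in T); first by rewrite mnmE (cell_indexK tau_inj tauT).
by have := a0 v; rewrite vT /= => /eqP.
Qed.

Lemma mdeg_on_alpha (f : {set V}) m : f \subset T ->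
  mdeg_on f (mnm_alpha m) = (\sum_(i | tau i \in f) m i)%N.
Proof.
move=> fT; rewrite /mdeg_on (big_cell tau_inj tauT) //.
by apply: eq_bigr => i _; rewrite mnm_alphaE.
Qed.

Lemma mdist_alpha (f : {set V}) m : Defs.mdist T f (mnm_alpha m) = mdeg_off tau f m.
Proof.
rewrite /Defs.mdist mdeg_on_alpha ?finset.subsetDl //.
by apply: eq_bigl => i; rewrite inE tau_in andbT.
Qed.

Lemma mdeg_on_cell m : mdeg_on T (mnm_alpha m) = mdeg m.
Proof.
rewrite mdeg_on_alpha // mdegE; apply: eq_bigl => i.
by rewrite tau_in.
Qed.

Lemma mlattice_alpha m : mdeg m = k -> mlattice k T (mnm_alpha m).
Proof.
move=> mk; apply/andP; split; last by rewrite -mk -mdeg_on_cell.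
by apply/forallP => v; apply/implyP => /negbTE vT; rewrite ffunE vT.
Qed.

Lemma mdeg_alpha_mnm alpha : mlattice k T alpha -> mdeg (alpha_mnm alpha) = k.
Proof. by move=> aT; rewrite -mdeg_on_cell alpha_mnmK // (mlattice_deg aT). Qed.

Lemma lam_monomialE (f : {set V}) m : f \subset T ->
  lam_monomial f (mnm_alpha m) = face_monomial X T tau f m.
Proof.
move=> fT; rewrite /lam_monomial (big_cell tau_inj tauT) //.
by apply: eq_bigr => i _; rewrite mnm_alphaE.
Qed.

(** Strong induction on the dimension of subfaces e of [f0], then induction on the distance s to e.
    Only functionals on subfaces of [f0] are assumed to vanish, so that both a whole cell and the
    common face of two cells are covered. *)
Lemma bernstein_face_vanish (l0 : nat) (f0 : {set V}) (p : mpoly n.+1 R) :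
  p \is ishomog1 k mdeg -> f0 \in Delta l0 T ->
  (forall l (e : {set V}) s alpha (b : multinom (n - l)), e \subset f0 ->
     dof_index T e s alpha b -> dof T e alpha b (bernstein X T tau p) = 0) ->
  forall m, m \in msupp p -> (r l0 < mdeg_off tau f0 m)%N.
Proof.
move=> pk f0l dof0.
suff H l e : e \in Delta l T -> e \subset f0 ->
    forall m, m \in msupp p -> (r l < mdeg_off tau e m)%N.
  exact: H f0l (fintype.subxx _).
elim/ltn_ind: l e => l IH e el ef0.
have [eT ec] := DeltaP _ _ _ el.
have eN0 : e != finset.set0 by rewrite -card_gt0 ec.
suff Hs s : (s <= (r l).+1)%N ->
    forall m, m \in msupp p -> (s <= mdeg_off tau e m)%N.
  exact: Hs.
elim: s => [//|s IHs]; rewrite ltnS => sl.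
apply: (bernstein_step Tn Tind tau_inj tauT eT eN0 pk (IHs (leqW sl))
  (dof_frame_surj el)).
move=> m b mp ms bs; have mk : mdeg m = k := dhomogP _ _ _ pk m mp.
rewrite -lam_monomialE // -dofE; apply: (dof0 _ _ s) => //.
have aT := mlattice_alpha mk.
split=> //.
- apply/andP; split; first by rewrite /mball aT mdist_alpha ms.
  (* A monomial in the ball of a smaller face cannot occur in p, by the outer induction; what
     remains at distance s lies in the index set of e. *)
  apply/negP => /existsP[i /existsP[e' /andP[ie' /andP[_]]]].
  rewrite mdist_alpha leqNgt; apply/negP; rewrite negbK.
  apply: (IH i (ltn_ord i)) => //; first exact: Delta_trans ie' el.
  by apply: fintype.subset_trans ef0; have [] := DeltaP _ _ _ ie'.
- by rewrite -[k](mlattice_deg aT) -(mdeg_onID _ eT) mdist_alpha ms addnK.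
Qed.

End OneCell.
End Dofs.

(** * Unisolvence on a cell and matching across cells *)

Lemma multinoms_of_degree (N k : nat) : exists ms : seq (multinom N),
  uniq ms /\ forall m, (m \in ms) = (mdeg m == k).
Proof.
exists [seq m <- [seq bmnm b | b <- enum {: bmultinom N k.+1}] | mdeg m == k].
split=> [|m].
  by rewrite filter_uniq // map_inj_uniq ?enum_uniq //; apply: val_inj.
rewrite mem_filter; case: eqP => //= mk; apply/mapP.
have mk1 : (mdeg m < k.+1)%N by rewrite mk.
by exists (BMultinom mk1); rewrite ?mem_enum.
Qed.

Section Unisolvence.
Variables (R : realType) (n : nat) (V : finType) (X : V -> 'rV[R]_n).
Variables (k : nat) (r : nat -> nat).
Variable nf : forall l : nat, {set V} -> 'M[R]_(n - l, n).
Hypothesis rn : r n = 0%N.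
Hypothesis r_double : forall l, (l.+2 <= n)%N -> (2 * r l.+1 <= r l)%N.
Hypothesis rk : (2 * r 0 + 1 <= k)%N.

Section OneCell.
Variable T : {set V}.
Hypotheses (Tn : #|T| = n.+1) (Tind : affinely_independent X T).
Hypothesis nfT : forall l f, (1 <= l <= n.-1)%N -> f \in Delta l T ->
  normal_frame X f (nf l f).

Lemma cell_off_card l (f : {set V}) : f \in Delta l T -> #|T :\: f| = (n - l)%N.
Proof.
case/DeltaP => fT fc.
by rewrite cardsD (finset.setIidPr fT) Tn fc subSS.
Qed.

Lemma dof_index_lattice l (f : {set V}) s alpha (b : multinom (n - l)) :
  dof_index k r T f s alpha b ->
  [/\ f \subset T, mlattice k T alpha & (mdeg_on f alpha + mdeg b = k)%N].
Proof.
case=> fl sl fS fa bs; have [fT _] := DeltaP _ _ _ fl.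
split=> //; first by case/andP: fS => /andP[].
rewrite fa bs subnK //.
have := r_mono rn r_double (leq0n l) (Delta_leq Tn fl); lia.
Qed.

(** The vanishing lemma at f0 = T puts every monomial at positive distance from T; no vertex of T
    lies off T, so there is no monomial. *)
Lemma dof_eq0 (p : mpoly n R) : (msize p <= k.+1)%N ->
  (forall l (f : {set V}) s alpha (b : multinom (n - l)),
     dof_index k r T f s alpha b -> dof X nf T f alpha b p = 0) ->
  p = 0.
Proof.
move=> pk dof0; have [tau tau_inj tauT] := cell_vertices Tn.
have [q qk qE] := bernstein_surj Tn Tind tau_inj tauT pk.
have TT : T \in Delta n T by apply/DeltaP.
have := bernstein_face_vanish Tn Tind nfT tau_inj tauT qk TT (r := r).
rewrite qE => H; rewrite -qE; suff -> : q = 0 by rewrite /bernstein raddf0.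
apply/eqP; rewrite -msupp_eq0; case E: (msupp q) => [//|m s].
have : (r n < mdeg_off tau T m)%N.
  by apply: H => [l e s' alpha b _|]; [apply: dof0 | rewrite E inE eqxx].
by rewrite /mdeg_off big1 // => i; rewrite (tau_in tauT).
Qed.

Lemma has_dofs_uniq D (p q : mpoly n R) :
  (msize p <= k.+1)%N -> (msize q <= k.+1)%N ->
  has_dofs X k r nf T D p -> has_dofs X k r nf T D q -> p = q.
Proof.
move=> pk qk pD qD; apply/eqP; rewrite -subr_eq0; apply/eqP/dof_eq0.
  by apply: leq_trans (msizeD_le _ _) _; rewrite msizeN geq_max pk.
move=> l f s alpha b I.
by rewrite (dofB _ Tn Tind) (pD _ _ _ _ _ I) (qD _ _ _ _ _ I) subrr.
Qed.

(** One functional is selected per multi-index of degree k, on the face given by the lattice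
    decomposition. The resulting square matrix is injective because its kernel consists of
    polynomials all of whose functionals vanish. *)
Lemma has_dofs_exists
    (D : forall l, {set V} -> {ffun V -> nat} -> multinom (n - l) -> R) :
  exists2 u : mpoly n R, (msize u <= k.+1)%N & has_dofs X k r nf T D u.
Proof.
have [tau tau_inj tauT] := cell_vertices Tn; pose v0 := tau ord0.
have [ms [ms_uniq mem_ms]] := multinoms_of_degree n.+1 k.
(* The dimension is recovered as [#|f|.-1], so the type of the derivative index depends on the
   chosen face alone. *)
pose good (m : multinom n.+1) (f : {set V}) := mdeg m = k ->
  f \in Delta #|f|.-1 T /\ Sface k r T #|f|.-1 f (mnm_alpha T tau m).
have [fm fmP] : {fm & forall m, good m (fm m)}.
  apply: boolp.choice => m; have [mk|mk] := eqVneq (mdeg m) k; last first.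
    by exists T => /eqP; rewrite (negbTE mk).
  have [l [f [fl fS]]] :=
    Sface_exists r Tn (mlattice_alpha tau_inj tauT mk).
  by exists f => _; have [_ ->] := DeltaP _ _ _ fl.
pose b_ (f : {set V}) (m : multinom n.+1) : multinom (n - #|f|.-1) :=
  off_index T f v0 (n - #|f|.-1) (mnm_alpha T tau m).
pose phi f m u := dof X nf T f (mnm_alpha T tau m) (b_ f m) u.
pose val_ (E : forall l, {set V} -> {ffun V -> nat} -> multinom (n - l) -> R)
  (f : {set V}) m := E #|f|.-1 f (Defs.mrestr f (mnm_alpha T tau m)) (b_ f m).
(* The functional indexed by (alpha, b) is the selected one for the multi-index equal to alpha on f
   and b off f; uniqueness of the face identifies f with [fm m]. *)
have all_dofs E u : (forall m, mdeg m = k -> phi (fm m) m u = val_ E (fm m) m) ->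
    has_dofs X k r nf T E u.
  move=> H l f s alpha b /[dup] I /dof_index_lattice[fT aT ab].
  case: I => fl sl fS fa bs; have Tf := cell_off_card fl.
  pose alpha' := spread T f alpha b.
  have aT' : mlattice k T alpha' := mlattice_spread v0 fT Tf ab.
  have aa' v : v \in f -> alpha v = alpha' v by move=> vf; rewrite /alpha' spread_in.
  have fS' : Sface k r T l f alpha' := Sface_transfer fT fT aT aT' aa' fS.
  pose m := alpha_mnm tau alpha'.
  have mk : mdeg m = k := mdeg_alpha_mnm tau_inj tauT aT'.
  have mE : mnm_alpha T tau m = alpha' := alpha_mnmK tau_inj tauT aT'.
  have [gl gS] := fmP m mk; rewrite mE in gS.
  have fE : fm m = f := Sface_uniq rn r_double rk Tn gl fl gS fS'.
  have lE : l = #|f|.-1 by have [_ ->] := DeltaP _ _ _ fl.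
  subst l; have := H m mk; rewrite fE /phi /val_ /b_ mE (off_indexK _ Tf).
  rewrite (eq_dof _ Tn Tind (alpha' := alpha)) => [->|v vf]; last by rewrite aa'.
  congr (E _ _ _ _); apply/ffunP => v; rewrite [LHS]ffunE [RHS]ffunE.
  by case: ifP => // /aa'.
pose A : 'M[R]_(size ms) := \matrix_(i, j)
  phi (fm (nth mnm0 ms j)) (nth mnm0 ms j)
    (bernstein X T tau (mpolyX R (nth mnm0 ms i))).
pose p (c : 'rV[R]_(size ms)) : mpoly n.+1 R :=
  \sum_i c 0 i *: mpolyX R (nth mnm0 ms i).
have nth_deg (i : 'I_(size ms)) : mdeg (nth mnm0 ms i) = k.
  by apply/eqP; rewrite -mem_ms mem_nth.
have pk c : p c \is ishomog1 k mdeg.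
  by apply: rpred_sum => i _; apply: rpredZ; rewrite dhomogX /= nth_deg.
have pA c (j : 'I_(size ms)) :
    phi (fm (nth mnm0 ms j)) (nth mnm0 ms j) (bernstein X T tau (p c)) =
    (c *m A) 0 j.
  rewrite /bernstein /p linear_sum /=.
  under eq_bigr do rewrite linearZ /=.
  rewrite /phi (dof_sum _ Tn Tind) mxE; apply: eq_bigr => i _.
  by rewrite [in RHS]mxE.
have psize c : (msize (bernstein X T tau (p c)) <= k.+1)%N :=
  msize_bernstein X T tau (pk c).
have p_dofs E c : (forall j : 'I_(size ms), (c *m A) 0 j =
      val_ E (fm (nth mnm0 ms j)) (nth mnm0 ms j)) ->
    has_dofs X k r nf T E (bernstein X T tau (p c)).
  move=> H; apply: all_dofs => m /eqP; rewrite -mem_ms => /(nthP mnm0)[j js <-].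
  by rewrite (pA c (Ordinal js)) H.
have Aunit : A \in unitmx.
  rewrite -row_free_unit -kermx_eq0; apply/eqP/row_matrixP => i; rewrite row0.
  set c := row i _; have cA : c *m A = 0.
    by apply/eqP; rewrite -sub_kermx row_sub.
  have cD := p_dofs (fun _ _ _ _ => 0) c.
  have TT : T \in Delta n T by apply/DeltaP.
  have vanish := bernstein_face_vanish Tn Tind nfT tau_inj tauT (pk c) TT (r := r).
  have pc0 : p c = 0.
    apply/eqP; rewrite -msupp_eq0; case E: (msupp (p c)) => [//|m s].
    have : (r n < mdeg_off tau T m)%N.
      apply: vanish => [l e s' alpha b _ I|]; last by rewrite E inE eqxx.
      rewrite (cD _ _ _ _ _ _ I) // => j.
      by rewrite cA mxE.
    by rewrite /mdeg_off big1 // => j; rewrite (tau_in tauT).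
  apply/rowP => j; rewrite [RHS]mxE -[RHS](mcoeff0 R (nth mnm0 ms j)) -pc0.
  rewrite /p raddf_sum (bigD1 j) //= mcoeffZ mcoeffX eqxx mulr1 big1 ?addr0 //.
  move=> j' j'j; rewrite mcoeffZ mcoeffX nth_uniq //.
  by rewrite (inj_eq val_inj) (negbTE j'j) mulr0.
exists (bernstein X T tau (p ((\row_j
  val_ D (fm (nth mnm0 ms j)) (nth mnm0 ms j)) *m invmx A))).
  exact: psize.
by apply: p_dofs => j; rewrite mulmxKV // mxE.
Qed.

End OneCell.

Section TwoCells.
Variables T T' : {set V}.
Hypotheses (Tn : #|T| = n.+1) (Tind : affinely_independent X T).
Hypotheses (Tn' : #|T'| = n.+1) (Tind' : affinely_independent X T').
Hypothesis nfT : forall l f, (1 <= l <= n.-1)%N -> f \in Delta l T ->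
  normal_frame X f (nf l f).

Lemma dof_transfer l (e : {set V}) (alpha alpha' : {ffun V -> nat})
    (b : multinom (n - l)) u :
  e \subset T -> e \subset T' -> (forall v, v \in e -> alpha v = alpha' v) ->
  dof X nf T e alpha b u = dof X nf T' e alpha' b u.
Proof.
move=> eT eT' aa; rewrite /dof; apply: eq_simplex_int => x w xw.
congr (_ * _); rewrite /bary_monomial; apply: eq_bigr => v ve.
by rewrite (bary_face Tn Tind eT xw) (bary_face Tn' Tind' eT' xw) aa.
Qed.

(** Regard p - q as one polynomial on T. On subfaces of the common face, the functionals of q
    computed in T equal those computed in T', so they cancel those of p and the coefficients near
    the face vanish. *)
Lemma face_match D (p q : mpoly n R) (l0 : nat) (x : 'rV[R]_n) (g : multinom n) :
  (msize p <= k.+1)%N -> (msize q <= k.+1)%N ->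
  has_dofs X k r nf T D p -> has_dofs X k r nf T' D q ->
  T :&: T' \in Delta l0 T -> (l0 < n)%N -> (mdeg g <= r l0)%N ->
  simplex_hull X (T :&: T') x ->
  peval (mderivm g p) x = peval (mderivm g q) x.
Proof.
move=> pk qk pD qD; set f := T :&: T' => fl l0n gr [w xw _].
have fT : f \subset T := finset.subsetIl _ _.
have fT' : f \subset T' := finset.subsetIr _ _.
have [tau tau_inj tauT] := cell_vertices Tn.
have hk : (msize (p - q) <= k.+1)%N.
  by apply: leq_trans (msizeD_le _ _) _; rewrite msizeN geq_max pk.
have [h hh hE] := bernstein_surj Tn Tind tau_inj tauT hk.
have vanish : forall m, m \in msupp h -> (r l0 < mdeg_off tau f m)%N.
  apply: (bernstein_face_vanish Tn Tind nfT tau_inj tauT hh fl).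
  move=> l e s alpha b ef I; rewrite hE (dofB _ Tn Tind) (pD _ _ _ _ _ I).
  have [eT aT ab] := dof_index_lattice Tn I; have eT' := fintype.subset_trans ef fT'.
  have ec : (#|e| < #|T'|)%N.
    apply: leq_ltn_trans (subset_leq_card ef) _.
    by rewrite Tn'; have [_ ->] := DeltaP _ _ _ fl.
  (* The face e is a proper face of T', which leaves a vertex to absorb the missing degree of
     alpha. *)
  have [v vT'e] : exists v, v \in T' :\: e.
    apply/finset.set0Pn; rewrite -card_gt0 cardsD (finset.setIidPr eT').
    by rewrite subn_gt0.
  have ek : (mdeg_on e alpha <= k)%N by rewrite -ab leq_addr.
  have [alpha' aT' a'a] := mlattice_extend eT' vT'e ek.
  have aa' i : i \in e -> alpha i = alpha' i by move=> ie; rewrite a'a.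
  rewrite (dof_transfer _ _ eT eT' aa').
  have I' : dof_index k r T' e s alpha' b.
    case: I => el sl eS ea bs; split=> //.
    - by apply/DeltaP; split=> //; have [] := DeltaP _ _ _ el.
    - exact: Sface_transfer eT eT' aT aT' aa' eS.
    - by rewrite -(eq_mdeg_on aa').
  rewrite (qD _ _ _ _ _ I'); apply/eqP; rewrite subr_eq0; apply/eqP.
  by congr (D _ _ _ _); apply/ffunP => i; rewrite !ffunE; case: ifP => // /aa'.
have x0 v : v \notin f -> bary X T x v = 0.
  by move=> vf; rewrite (bary_face Tn Tind fT xw); case: xw => ->.
(* The standard basis as frame yields all partial derivatives, tangential ones included. *)
have := bernstein_der_face_eq0 Tn Tind 1%:M vanish gr x0.
rewrite hE frame_der1 mderivmB /peval mevalB => /eqP.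
by rewrite subr_eq0 => /eqP.
Qed.

End TwoCells.
End Unisolvence.

(** * The finite element space *)

Lemma simplex_int_vertex (R : realType) (n : nat) (V : finType)
    (X : V -> 'rV[R]_n) (v : V) (g : 'rV[R]_n -> R) :
  simplex_int X [set v]%SET g = g (X v).
Proof.
by rewrite /simplex_int enum_set1 det_mx00 sqrtr1 mul1r /= mul0mx addr0.
Qed.

Lemma frame_der_empty (R : realType) (n q : nat) (W : 'M[R]_(q, n))
    (b : multinom q) (p : mpoly n R) : q = 0%N -> frame_der W b p = p.
Proof.
move=> q0; subst q; rewrite /frame_der.
by rewrite (_ : enum 'I_0 = [::]) //; apply: size0nil; rewrite size_enum_ord.
Qed.

Section SplitDofs.
Variables (R : realType) (n : nat) (V : finType) (X : V -> 'rV[R]_n).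
Variables (k : nat) (r : nat -> nat) (Th : {set {set V}}).
Variable nf : forall l : nat, {set V} -> 'M[R]_(n - l, n).
Variables (d0 : V -> multinom n -> R)
  (d1 : forall l : nat, {set V} -> {ffun V -> nat} -> multinom (n - l) -> R)
  (d2 : {set V} -> {ffun V -> nat} -> R).
Hypothesis n0 : (0 < n)%N.
Hypothesis rn : r n = 0%N.
Hypothesis rk : (r 0 <= k)%N.
Hypothesis Th_dim : forall T, T \in Th -> #|T| = n.+1.
Hypothesis Th_ind : forall T, T \in Th -> affinely_independent X T.

Definition merged_dofs (l : nat) (f : {set V}) (a : {ffun V -> nat})
    (b : multinom (n - l)) : R :=
  if l == 0%N then (if [pick v in f] is Some v then d0 v (mcast n b) else 0)
  else if l == n then d2 f a else d1 f a b.

Lemma dof_vertex T v alpha (b : multinom (n - 0)) u : T \in Th -> v \in T ->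
  dof X nf T [set v]%SET alpha b u = peval (mderivm (mcast n b) u) (X v).
Proof.
move=> TT vT; rewrite /dof simplex_int_vertex frame_der_pid ?subn0 //.
rewrite /bary_monomial big_set1.
have xv : bary_coords X [set v]%SET (X v) (fun i => (i == v)%:R).
  split=> [i|| ]; rewrite ?big_set1 ?eqxx ?scale1r //.
  by rewrite inE => /negbTE ->.
rewrite (bary_face (Th_dim TT) (Th_ind TT) _ xv) ?finset.sub1set //.
by rewrite eqxx expr1n mulr1.
Qed.

Lemma dof_cell T alpha (b : multinom (n - n)) u :
  dof X nf T T alpha b u =
  simplex_int X T (fun x => peval u x * bary_monomial X T T alpha x).
Proof.
by rewrite /dof; under eq_fun do rewrite frame_der_empty ?subnn //.
Qed.

Lemma mrestr_lattice (T : {set V}) (alpha : {ffun V -> nat}) :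
  mlattice k T alpha -> Defs.mrestr T alpha = alpha.
Proof.
case/andP => /forallP a0 _; apply/ffunP => v; rewrite ffunE.
by have := a0 v; case: (v \in T) => //= /eqP.
Qed.

Lemma merged_dofsP u :
  vertex_dofs X r Th u d0 /\ face_dofs X k r Th nf u d1 /\
    cell_dofs X k r Th u d2 <->
  forall T, T \in Th -> has_dofs X k r nf T merged_dofs (u T).
Proof.
split=> [[U0 [U1 U2]] T TT l f s alpha b [fl sl fS fa bs]|H].
- have [fT fc] := DeltaP _ _ _ fl; have ln := Delta_leq (Th_dim TT) fl.
  rewrite /merged_dofs; case: eqP => [l0|/eqP l0].
    subst l; have /cards1P[v fE] : #|f| == 1%N by rewrite fc.
    rewrite fE in fT *; rewrite finset.sub1set in fT.
    rewrite dof_vertex //; case: pickP => [w /finset.set1P ->|/(_ v)]; last first.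
      by rewrite inE eqxx.
    by apply: U0 => //; rewrite mdeg_mcast ?subn0 // bs.
  case: eqP => [lE|/eqP lN].
    subst l; have fE : f = T by apply/eqP; rewrite eqEcard fT fc (Th_dim TT) leqnn.
    subst f; rewrite dof_cell.
    have aT : mlattice k T alpha by case/andP: fS => /andP[].
    rewrite (mrestr_lattice aT); apply: U2 => //.
    by case/andP: fS => /andP[_ _] ?; apply/andP.
  have l1 : (1 <= l <= n.-1)%N by rewrite lt0n l0 /=; move: ln lN; lia.
  rewrite -(U1 T l f TT l1 fl s alpha b sl fS fa bs).
  by rewrite /dof; case: l l0 {l1 lN ln fl fS fa sl fc} b bs.
split; last split.
- move=> T v TT vT alpha a_r.
  have [b bE] := mcast_surj alpha (subn0 n).
  have vl : [set v]%SET \in Delta 0 T.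
    by apply/DeltaP; rewrite finset.sub1set cards1.
  (* A second vertex of T, available since n > 0, carries the degree not placed at v. *)
  have [w] : exists w, w \in T :\: [set v]%SET.
    apply/finset.set0Pn; rewrite -card_gt0 cardsD.
    by rewrite (finset.setIidPr _) ?finset.sub1set // cards1 (Th_dim TT) subn1.
  pose a0 : {ffun V -> nat} := [ffun=> (k - mdeg alpha)%N].
  have a0v : mdeg_on [set v]%SET a0 = (k - mdeg alpha)%N.
    by rewrite /mdeg_on big_set1 ffunE.
  have [vT' _] := DeltaP _ _ _ vl.
  move=> wT; have ak : (mdeg_on [set v]%SET a0 <= k)%N by rewrite a0v leq_subr.
  have [a1 a1T a1E] := mlattice_extend vT' wT ak.
  have a1v : mdeg_on [set v]%SET a1 = (k - mdeg alpha)%N.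
    by rewrite (eq_mdeg_on a1E).
  have I : dof_index k r T [set v]%SET (mdeg alpha) a1 b.
    split=> //; last by rewrite -bE mdeg_mcast ?subn0.
    (* The distance k - (k - |alpha|) is |alpha|, as |alpha| <= r 0 <= k, and no faces lie below a
       vertex. *)
    rewrite SfaceE // a1T a1v subKn ?(leq_trans a_r) //=.
    by apply/negP => /existsP[[]].
  have := H T TT _ _ _ _ _ I.
  rewrite dof_vertex // bE => ->; rewrite /merged_dofs eqxx.
  case: pickP => [w' /finset.set1P ->|/(_ v)]; last by rewrite inE eqxx.
  by rewrite bE.
- move=> T l f TT l1 fl s alpha b sl fS fa bs.
  have := H T TT l f s alpha b (And5 fl sl fS fa bs).
  rewrite /merged_dofs ifF; last by apply/negbTE; rewrite -lt0n; case/andP: l1.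
  rewrite ifF; last by apply/negbTE; move: l1 n0; lia.
  by move=> <-; rewrite /dof; case: l l1 {fl sl fS fa} b bs.
- move=> T TT alpha /andP[aT aN].
  have TTn : T \in Delta n T by apply/DeltaP; rewrite (Th_dim TT).
  have I : dof_index k r T T 0 alpha (mnm0 : multinom (n - n)).
    split=> //; last exact: mdeg0.
      by rewrite /Sface /mball aT aN andbT /Defs.mdist finset.setDv /mdeg_on big_set0.
    by rewrite subn0 (mlattice_deg aT).
  have := H T TT _ _ _ _ _ I.
  rewrite dof_cell => ->; rewrite /merged_dofs (gtn_eqF n0) eqxx.
  by rewrite (mrestr_lattice aT).
Qed.

End SplitDofs.

Theorem theoremA8 (R : realType) (n m k : nat) (r : nat -> nat)
    (V : finType) (X : V -> 'rV[R]_n) (Omega : set 'rV[R]_n)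
    (Th : {set {set V}})
    (nf : forall l : nat, {set V} -> 'M[R]_(n - l, n)) :
  (1 <= n)%N ->
  r n = 0%N -> r n.-1 = m ->
  (forall l : nat, (l.+2 <= n)%N -> (2 * r l.+1 <= r l)%N) ->
  (2 * r 0 + 1 <= k)%N -> (2 ^ n * m + 1 <= 2 * r 0 + 1)%N ->
  is_domain Omega ->
  conforming_mesh X Omega Th ->
  (forall (T : {set V}) (l : nat) (f : {set V}),
     T \in Th -> (1 <= l <= n.-1)%N -> f \in Delta l T ->
     normal_frame X f (nf l f)) ->
  forall (d0 : V -> multinom n -> R)
    (d1 : forall l : nat, {set V} -> {ffun V -> nat} -> multinom (n - l) -> R)
    (d2 : {set V} -> {ffun V -> nat} -> R),
  let takes_values (u : {set V} -> mpoly n R) :=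
    [/\ piecewise_poly k Th u,
        vertex_dofs X r Th u d0,
        face_dofs X k r Th nf u d1 &
        cell_dofs X k r Th u d2] in
  exists u : {set V} -> mpoly n R,
    [/\ takes_values u,
        forall u', takes_values u' -> forall T, T \in Th -> u' T = u T &
        exists2 U : 'rV[R]_n -> R,
          forall T x, T \in Th -> simplex_hull X T x -> U x = peval (u T) x &
          classC m Omega U].
Proof.
move=> n0 rn rm r_double rk _ [Oopen _ _] [Th_dim Th_ind Th_conf Th_cover] nfP.
move=> d0 d1 d2 takes_values.
have rk0 : (r 0 <= k)%N by lia.
have takesP u : takes_values u <-> forall T, T \in Th ->
    (msize (u T) <= k.+1)%N /\ has_dofs X k r nf T (merged_dofs d0 d1 d2) (u T).
  have mP := merged_dofsP nf d0 d1 d2 n0 rn rk0 Th_dim Th_ind u.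
  split=> [[pu u0 u1 u2] T TT|H].
    by split; [apply: pu | apply: (iffLR mP)].
  have [u0 [u1 u2]] := iffRL mP (fun T TT => (H T TT).2).
  by split=> // T TT; have [] := H T TT.
have [u uP] : {u : {set V} -> mpoly n R & forall T, T \in Th ->
    (msize (u T) <= k.+1)%N /\ has_dofs X k r nf T (merged_dofs d0 d1 d2) (u T)}.
  apply: (@boolp.choice _ _ (fun T (p : mpoly n R) => T \in Th ->
    (msize p <= k.+1)%N /\ has_dofs X k r nf T (merged_dofs d0 d1 d2) p)) => T.
  have [TT|_] := boolP (T \in Th); last by exists 0.
  have [p pk pD] := has_dofs_exists rn r_double rk (Th_dim T TT) (Th_ind T TT)
    (fun l f => nfP T l f TT) (merged_dofs d0 d1 d2).
  by exists p.
exists u; split; first exact/takesP.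
  move=> u' /takesP u'P T TT.
  have [uk uD] := uP T TT; have [u'k u'D] := u'P T TT.
  exact: (has_dofs_uniq (Th_dim T TT) (Th_ind T TT)
    (fun l f => nfP T l f TT) u'k uk u'D uD).
(* Two distinct cells meet in dimension l < n, where r l >= r n.-1 = m. *)
have m_le l : (l < n)%N -> (m <= r l)%N.
  by move=> ln; rewrite -rm; apply: (r_mono rn r_double); move: ln; case: (n) => //=; lia.
have match_ (g : multinom n) T T' x : (mdeg g <= m)%N -> T \in Th -> T' \in Th ->
    simplex_hull X T x -> simplex_hull X T' x ->
    peval (mderivm g (u T)) x = peval (mderivm g (u T')) x.
  move=> gm TT TT' Tx T'x.
  have [->//|TnT'] := eqVneq T T'.
  have fx : simplex_hull X (T :&: T') x by rewrite -Th_conf.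
  have [l fc] : exists l, #|T :&: T'| = l.+1.
    (* The intersection contains x, and weights on an empty set cannot sum to 1. *)
    case fc: #|T :&: T'| => [|l]; last by exists l.
    move/eqP: fc; rewrite cards_eq0 => /eqP f0; case: fx => w [_ + _] _.
    by rewrite f0 big_set0 => /eqP; rewrite eq_sym oner_eq0.
  have ln : (l < n)%N.
    rewrite -ltnS -(Th_dim T TT) -fc; apply: fintype.proper_card.
    rewrite fintype.properE finset.subsetIl /=; apply: contraNN TnT'.
    rewrite finset.subsetI fintype.subxx /= => TT'_sub.
    by rewrite eqEcard TT'_sub (Th_dim T TT) (Th_dim T' TT') leqnn.
  have fl : T :&: T' \in Delta l T by apply/DeltaP; rewrite finset.subsetIl.
  have [uk uD] := uP T TT; have [u'k u'D] := uP T' TT'.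
  apply: (face_match rn r_double rk (Th_dim T TT) (Th_ind T TT) (Th_dim T' TT')
    (Th_ind T' TT') (fun l f => nfP T l f TT) uk u'k uD u'D fl ln _ fx).
  exact: leq_trans gm (m_le l ln).
(* One cell is chosen for each point of the mesh; matching at order 0 makes the value of U
   independent of this choice. *)
have [c cP] : {c : 'rV[R]_n -> {set V} & forall x,
    (exists2 T, T \in Th & simplex_hull X T x) ->
    c x \in Th /\ simplex_hull X (c x) x}.
  apply: (@boolp.choice _ _ (fun x T =>
    (exists2 T', T' \in Th & simplex_hull X T' x) ->
    T \in Th /\ simplex_hull X T x)) => x.
  have [[T TT Tx]|nT] := pselect (exists2 T, T \in Th & simplex_hull X T x).
    by exists T.
  by exists finset.set0.
have UE T x : T \in Th -> simplex_hull X T x ->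
    peval (u (c x)) x = peval (u T) x.
  move=> TT Tx; have [cT cx] := cP x (ex_intro2 _ _ T TT Tx).
  by have := match_ mnm0 _ _ x _ cT TT cx Tx; rewrite !mderivm0m mdeg0; apply.
exists (fun x => peval (u (c x)) x); first by move=> T x; apply: UE.
(* Start with no derivative taken and m left to take. *)
apply: (@classC_paste R n {set V} Th (simplex_hull X) Omega u m _ Oopen _ _ m mnm0).
- by move=> T TT; apply: (closed_simplex_hull (Th_dim T TT) (Th_ind T TT)).
- move=> x /subset_closure; rewrite -Th_cover => -[T TT Tx].
  by exists T.
- by move=> g T T' x; apply: match_.
- by rewrite mdeg0.
- by move=> T x _ TT Tx; rewrite mderivm0m; apply: UE.
Qed.
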